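(* Suppose that conditions (C1), (C2) and (C3) (stated in the context) hold for the branching Markov chain with offspring distribution $p$ and transition probability $P$. Then there exists a unique probability measure $\mathbf{Q}_{\rm min}$ on $\mathfrak{N}^{\circ}(\mathbb{R})$ such that for every $\mu\in\mathfrak{N}^{\circ}(\mathbb{R})$, $$\mathbb{P}_{\mu}(Z_n\in\cdot\mid N_n>0)\longrightarrow \mathbf{Q}_{\rm min}(\cdot)\quad\text{weakly as } n\to\infty.$$
   Context: Let $\mathbb{N}=\{0,1,2,\dots\}$. Let $p=\{p_j\}_{j\in\mathbb{N}}$ be a probability measure on $\mathbb{N}$ (offspring distribution) with mean $m=\sum_j jp_j$, and let $P$ be a transition probability (Markov kernel) on $\mathbb{R}$, with $n$-step transition probability $P_n$; write $P_nh(x)=\int h(y)P_n(x,\mathrm{d}y)$. $\mathfrak{N}(\mathbb{R})$ is the space of finite integer-valued Borel measures (finite point measures) on $\mathbb{R}$ with the topology of weak convergence, $\mathbf{0}$ the null measure, $\mathfrak{N}^{\circ}(\mathbb{R})=\mathfrak{N}(\mathbb{R})\setminus\{\mathbf{0}\}$. $\mathcal{B}_b^+(\mathbb{R})$ is the set of bounded nonnegative Borel functions on $\mathbb{R}$. Branching Markov chain: under $\mathbb{P}_{\delta_x}$, generation $0$ consists of one particle at $x$. Each particle of generation $n$, independently of the others of its generation, is replaced after one unit of time by a random number of children with law $p$; given that the parent is at $y$, the children are positioned independently according to $P(y,\cdot)$; they form generation $n+1$. For $\mu=\sum_i\delta_{x_i}\in\mathfrak{N}^\circ(\mathbb{R})$,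 under $\mathbb{P}_\mu$ the system is the union of independent branching Markov chains started from single particles at the $x_i$. $Z_n$ is the counting measure on $\mathbb{R}$ of the positions of the particles of generation $n$, and $N_n=Z_n(\mathbb{R})$. Conditions. (C1): $0<m<1$ and $p$ has finite moments of all orders. (C2): $\limsup_{n\to\infty}(p_n)^{1/n}\in[0,1)$. (C3): there exists a probability measure $\pi$ on $\mathbb{R}$ such that $P_nh(x)\to\pi(h):=\int h\,\mathrm{d}\pi$ as $n\to\infty$ for every $x\in\mathbb{R}$ and every $h\in\mathcal{B}_b^+(\mathbb{R})$. *)

(* Defs.v *)
From HB Require Import structures.
From mathcomp Require Import all_boot all_order all_algebra.
From mathcomp Require Import all_classical all_reals all_analysis.

Set Implicit Arguments.
Unset Strict Implicit.
Unset Printing Implicit Defensive.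

Import Order.TTheory GRing.Theory Num.Theory.
Import numFieldNormedType.Exports.

Local Open Scope classical_set_scope.
Local Open Scope ring_scope.

Section offspring.
Context {R : realType} (p : probability nat R).
Local Open Scope ereal_scope.

Definition offspring_moment (k : nat) : \bar R :=
  \sum_(0 <= j <oo) (j ^ k)%:R%:E * p [set j].

Definition offspring_mean : \bar R := \sum_(0 <= j <oo) j%:R%:E * p [set j].

Definition condition_C1 : Prop :=
  0 < offspring_mean < 1 /\ forall k : nat, offspring_moment k < +oo.

Definition condition_C2 : Prop :=
  0 <= limn_esup (fun n : nat => (fine (p [set n]) `^ n%:R^-1)%:E) < 1.

End offspring.

Section kernel.
Context {R : realType}.
Local Open Scope ereal_scope.
Variable P : R.-pker measurableTypeR R ~> measurableTypeR R.

Fixpoint nstep (n : nat) : R.-spker measurableTypeR R ~> measurableTypeR R :=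
  if n is n'.+1 then mkcomp_noparam P (nstep n')
  else kdirac (@measurable_id _ (measurableTypeR R) setT).

Definition condition_C3 : Prop :=
  exists pi : probability (measurableTypeR R) R,
  forall h : measurableTypeR R -> R,
    measurable_fun setT h -> (forall y, (0 <= h y)%R) ->
    [bounded h y | y in setT] ->
  forall x : R,
    \int[nstep n x]_y (h y)%:E @[n --> \oo] --> \int[pi]_y (h y)%:E.

End kernel.

(* The values of a [{measure set _ -> _}] outside the Borel sets are
   irrelevant: point measures that agree on the Borel sets may differ as terms,
   but they are topologically indistinguishable. *)
Record point_measure (R : realType) := PointMeasure {
  pm_measure :> {measure set (measurableTypeR R) -> \bar R} ;
  pm_natural : forall A : set (measurableTypeR R), measurable A ->
    exists k : nat, pm_measure A = k%:R%:E }.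

HB.instance Definition _ (R : realType) := gen_eqMixin (point_measure R).
HB.instance Definition _ (R : realType) := gen_choiceMixin (point_measure R).

Record Cb (R : realType) := BoundedContinuous {
  Cb_fun :> R -> R ;
  Cb_continuous : continuous Cb_fun ;
  Cb_bounded : [bounded Cb_fun x | x in setT] }.

HB.instance Definition _ (R : realType) := gen_eqMixin (Cb R).
HB.instance Definition _ (R : realType) := gen_choiceMixin (Cb R).

Definition pm_integral (R : realType) (mu : point_measure R) :
    {ptws Cb R -> R} :=
  fun f => \int[mu]_x f x.

(* The topology of weak convergence is the coarsest one making
   mu |-> \int f dmu continuous for every bounded continuous f. *)
HB.instance Definition _ (R : realType) := Topological.copy (point_measure R)
  (initial_topology (@pm_integral R)).

Section pm_of_seq.
Context {R : realType} (s : seq R).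

Definition sum_dirac : {measure set (measurableTypeR R) -> \bar R} :=
  msum (fun i => \d_(s`_i : measurableTypeR R)) (size s).

Lemma sum_dirac_natural (A : set (measurableTypeR R)) : measurable A ->
  exists k : nat, sum_dirac A = k%:R%:E.
Proof.
move=> _; exists (\sum_(i < size s) (nth 0%R s i \in A))%N.
rewrite natr_sum -sumEFin /sum_dirac /= /msum.
apply: eq_bigr => i _; exact: diracE.
Qed.

Definition pm_of_seq : point_measure R := PointMeasure sum_dirac_natural.

End pm_of_seq.

Record nz_point_measure (R : realType) := NzPointMeasure {
  nz_measure :> point_measure R ;
  nz_neq0 : nz_measure setT != 0%E }.

HB.instance Definition _ (R : realType) := [isSub for @nz_measure R].
HB.instance Definition _ (R : realType) :=
  [Choice of nz_point_measure R by <:].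

Lemma pm_of_seq1_neq0 (R : realType) : pm_of_seq [:: 0 : R] setT != 0%E.
Proof. by rewrite /= /msum big_ord1 [X in X != _]diracT onee_neq0. Qed.

HB.instance Definition _ (R : realType) :=
  isPointed.Build (nz_point_measure R)
    (NzPointMeasure (@pm_of_seq1_neq0 R)).

HB.instance Definition _ (R : realType) :=
  Topological.copy (nz_point_measure R) (initial_topology (@nz_measure R)).

Notation nz_borel R := (g_sigma_algebraType (@open (nz_point_measure R))).

Section branching.
Context {R : realType} {d : measure_display} {T : measurableType d}.

(* [fam n w] lists the particles of generation [n] (by position), grouped into
   families: for n = k.+1 the i-th family consists of the children of the i-th
   particle of generation k; the grouping of generation 0 is arbitrary. *)
Variable fam : nat -> T -> seq (seq R).

Definition generation (n : nat) (w : T) : seq R := flatten (fam n w).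

Definition Zn (n : nat) (w : T) : point_measure R := pm_of_seq (generation n w).

Definition Nn (n : nat) (w : T) : \bar R := Zn n w setT.

(* Families of sizes [ks], with the j-th member of the i-th one in [B i j]. *)
Definition family_box (ks : seq nat) (B : nat -> nat -> set (measurableTypeR R))
    : set (seq (seq R)) :=
  [set s | shape s = ks /\ forall i j, (i < size ks)%N ->
     (j < nth 0%N ks i)%N -> B i j (nth [::] s i)`_j].

Definition history (n : nat) : set (set T) :=
  <<s [set A | exists k ks B, [/\ (k <= n)%N,
         forall i j, measurable (B i j) &
         A = fam k @^-1` family_box ks B]] >>.

Variables (p : probability nat R)
  (P : R.-pker measurableTypeR R ~> measurableTypeR R).
Local Open Scope ereal_scope.

(* The last clause is the branching mechanism: given the history up to
   generation n, the particles of generation n reproduce independently; the one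
   at y has k children with probability [p [set k]], and given k the children
   are placed independently according to [P y]. *)
Definition branching_Markov_chain (Pr : probability T R) (mu : point_measure R)
    : Prop :=
  [/\ forall n w, size (fam n.+1 w) = size (generation n w),
      forall n A, history n A -> measurable A,
      {ae Pr, forall w, forall A : set (measurableTypeR R), measurable A ->
                Zn 0 w A = mu A} &
      forall n A ks B, history n A -> (forall i j, measurable (B i j)) ->
        Pr (A `&` fam n.+1 @^-1` family_box ks B) =
        \int[Pr]_(w in A `&` [set w | size (generation n w) = size ks])
          (\prod_(i < size ks)
             (fine (p [set nth 0%N ks i]) *
              \prod_(j < nth 0%N ks i)
                fine (P (nth 0%R (generation n w) i) (B i j))))%R%:E ].

(* E[f(Z_n) | N_n > 0]; [insubd point] sees the nonnull point measure Z_n as an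
   element of [nz_point_measure R]. *)
Definition survival_expectation (Pr : probability T R) (n : nat)
    (f : nz_point_measure R -> R) : R :=
  ((\int[Pr]_(w in [set w | (0 < Nn n w)%E])
      f (insubd (point : nz_point_measure R) (Zn n w)))
   / fine (Pr [set w | (0 < Nn n w)%E]))%R.

(* Weak convergence of the laws Pr (Z_n \in . | N_n > 0) to Q, tested as usual
   against the bounded continuous functions. *)
Definition conditional_law_cvg (Pr : probability T R)
    (Q : probability (nz_borel R) R) : Prop :=
  forall f : nz_point_measure R -> R,
    continuous f -> [bounded f nu | nu in setT] ->
  survival_expectation Pr n f @[n --> \oo] --> (\int[Q]_nu f nu)%R.

End branching.

(* Main.v *)
(** Let q_n be the probability that a single line survives n generations and,
    for a set D of nonempty finite configurations, let v_n(x) be the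
    probability that generation n, started from one particle at x, is in D.  If
    two or more children of the ancestor have descendants n generations later,
    which costs O(q_n^2) because p has a second moment, the n-th generation is
    not that of a single child; hence v_(n+1) = m P v_n + O(q_n^2), uniformly in
    D and x.  As q_n <= m^n, the functions w_n = v_n / m^n satisfy
    |w_(n+k) - P_k w_n| <= C m^n.  By (C3), w_n(x) therefore converges to a limit
    ell(D) that does not depend on x, and ell is within C m^n of the measure
    D |-> pi(w_n), uniformly in D: so ell is a measure, with no tightness
    argument.  Taking for D all nonempty configurations, the same recursion
    keeps q_n / m^n away from 0.  The limit law is ell / ell(all), carried from
    ordered configurations to point measures. *)
Require Import Defs.
From HB Require Import structures.
From mathcomp Require Import all_boot all_order all_algebra.
From mathcomp Require Import all_classical all_reals all_analysis.
From mathcomp Require Import measurable_realfun giry lra.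

Set Implicit Arguments.
Unset Strict Implicit.
Unset Printing Implicit Defensive.

Import Order.TTheory GRing.Theory Num.Theory.
Import numFieldNormedType.Exports.

Local Open Scope classical_set_scope.
Local Open Scope ring_scope.

(** * Finite sequences as a measurable space *)

(** The probabilistic work is done on ordered lists because everything is explicit there: boxes,
    with a prescribed length and one Borel side per entry, determine laws, and the law of the next
    generation on a box is a finite sum of products. Convergence obtained on lists is setwise, so it
    extends to every bounded measurable function, in particular to f composed with [nzpm] for a
    bounded continuous f on point measures. The constant C is [defect] / (1 - m), where [defect] is
    E[k^2] / m: it sums the geometric series of the one-step errors. The initial configuration is
    given only almost surely and up to order; its size alone survives in the limit, and it cancels
    in the conditional ratio. The other obstacle is the space of point measures, whose topology is
    only given as an initial one: its Borel sets are reached through lists, where rational boxes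
    form a countable family. This yields the measurability of [nzpm] and, with the complete
    regularity of the pointwise topology, the fact that bounded continuous functions determine a
    probability. *)

HB.instance Definition _ (T : pointedType) := isPointed.Build (seq T) [::].

Section measurable_lists.
Context {d : measure_display} {X : measurableType d}.
Implicit Types (Cs Ds : seq (set X)) (s t : seq X).

Fixpoint box Cs : set (seq X) := fun s =>
  match Cs, s with
  | [::], [::] => True
  | C :: Cs', x :: s' => C x /\ box Cs' s'
  | _, _ => False
  end.

(** A pi-system in which every nonempty member fixes the length. The boxes with all sides [setT] cut
    the lists into countably many pieces, so that finite measures are determined on boxes. *)
Definition mboxes : set (set (seq X)) :=
  [set box Cs | Cs in [set Cs | forall C, C \in Cs -> measurable C]].

Lemma boxP x0 Cs s : box Cs s <-> size s = size Cs /\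
  forall j, (j < size Cs)%N -> nth setT Cs j (nth x0 s j).
Proof.
elim: Cs s => [|C Cs IH] [|x s]/=; split=> //.
- by case.
- by case.
- move=> [Cx /IH[-> h]]; split => // -[|j]//=.
  by rewrite ltnS => /h.
- move=> [[us] h]; split; first exact: (h 0%N).
  by apply/IH; split=> // j jC; exact: (h j.+1).
Qed.

Lemma box_size Cs s : box Cs s -> size s = size Cs.
Proof. by move=> /(boxP point)[]. Qed.

Lemma boxT n s : box (nseq n setT) s <-> size s = n.
Proof.
split=> [/box_size|]; first by rewrite size_nseq.
move=> sn; apply/(boxP point); rewrite size_nseq; split=> // j jn.
by rewrite nth_nseq jn.
Qed.

Lemma box_cat Cs s t :
  box Cs (s ++ t) <->
  [/\ (size s <= size Cs)%N, box (take (size s) Cs) s &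
      box (drop (size s) Cs) t].
Proof.
elim: s Cs => [|x s IH] [|C Cs] /=; rewrite ?take0 ?drop0//=.
- by split => // -[].
- by split => // -[].
- by split => // -[].
- by rewrite ltnS; split => [[Cx /IH[]]|[? [Cx ?] ?]]//; split=> //; exact/IH.
Qed.

(** Once the shape is known, flattening loses nothing: each member of each family has a definite
    rank in the flat list. This is the bridge between [family_box], which speaks of families, and
    [box], which speaks of generations. *)
Lemma box_flatten_reshape x0 ks Cs (ss : seq (seq X)) : sumn ks = size Cs ->
  (shape ss = ks /\ box Cs (flatten ss)) <->
  (shape ss = ks /\ forall i j, (i < size ks)%N -> (j < nth 0%N ks i)%N ->
    nth setT (nth [::] (reshape ks Cs) i) j (nth x0 (nth [::] ss i) j)).
Proof.
elim: ks Cs ss => [|k ks IH] Cs ss /=.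
  by move=> /esym/size0nil ->; case: ss => [|s ss]; split=> -[].
move=> kCs; case: ss => [|s ss]/=; first by split=> -[].
have sD : sumn ks = size (drop k Cs) by rewrite size_drop -kCs addKn.
have kle : (k <= size Cs)%N by rewrite -kCs leq_addr.
have IHs := IH _ ss sD.
split=> -[[sk ssks]].
  rewrite sk ssks => /box_cat[_]; rewrite sk => /(boxP x0)[_ b1] b2.
  split=> // -[|i] j /=.
    by move=> _ jk; apply: b1; rewrite size_takel.
  by rewrite ltnS; apply: (IHs.1 (conj ssks b2)).2.
rewrite sk ssks => h; split=> //; apply/box_cat; rewrite sk; split => //.
  apply/(boxP x0); split; first by rewrite size_takel.
  by move=> j; rewrite size_takel// => jk; exact: (h 0%N j).
by apply: (IHs.2 _).2; split => // i j ik; exact: (h i.+1 j).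
Qed.

Lemma mboxesI : setI_closed mboxes.
Proof.
move=> _ _ [Cs mCs <-] [Ds mDs <-].
have [CD|CD] := eqVneq (size Cs) (size Ds); last first.
  (* The empty set is itself a box, with one empty side. *)
  exists [:: set0]; first by move=> C; rewrite inE => /eqP ->.
  apply/seteqP; split => s /=; first by case: s => //= x s [].
  by move=> [/box_size sC /box_size sD]; rewrite -sC -sD eqxx in CD.
exists [seq C.1 `&` C.2 | C <- zip Cs Ds].
  move=> _ /mapP[[C D] /= CDi ->]; apply: measurableI.
    by apply: mCs; rewrite -(unzip1_zip (eq_leq CD)); apply/mapP; exists (C, D).
  apply: mDs; rewrite -(unzip2_zip (eq_leq (esym CD))).
  by apply/mapP; exists (C, D).
elim: Cs Ds CD {mCs mDs} => [|C Cs IH] [|D Ds]//=.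
  by move=> _; apply/seteqP; split=> -[|x s]//= -[].
move=> [CD]; apply/seteqP; split => -[|x s]//=.
- by rewrite (IH _ CD) => -[[? ?] [? ?]].
- by case.
- by rewrite (IH _ CD) => -[[? ?] [? ?]].
Qed.

End measurable_lists.

Notation mseq X := (g_sigma_algebraType (@mboxes _ X)).

Section measurable_lists_maps.
Context {d : measure_display} {X : measurableType d}.
Implicit Types (Cs : seq (set X)).

Lemma measurable_box Cs : (forall C, C \in Cs -> measurable C) ->
  measurable (box Cs : set (mseq X)).
Proof. by move=> mCs; apply: sub_sigma_algebra; exists Cs. Qed.

Lemma measurable_size (n : nat) : measurable ([set s | size s = n] : set (mseq X)).
Proof.
rewrite (_ : mkset _ = box (nseq n setT)).
  by apply: measurable_box => C /nseqP[-> _].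
by apply/seteqP; split=> s /boxT.
Qed.

Lemma measurable_sizeP (P : set nat) :
  measurable ([set s | P (size s)] : set (mseq X)).
Proof.
rewrite (_ : mkset _ = \bigcup_(n in P) [set s | size s = n]).
  by apply: bigcup_measurable => n _; exact: measurable_size.
by apply/seteqP; split=> [s Ps|s [n Pn /= ->]//]; exists (size s).
Qed.

Lemma measurable_fun_mseq d' (Y : measurableType d') (D : set Y)
    (f : Y -> mseq X) : measurable D ->
  (forall Cs, (forall C, C \in Cs -> measurable C) ->
    measurable (D `&` f @^-1` box Cs)) ->
  measurable_fun D f.
Proof.
move=> mD mf; apply: (@measurability _ _ Y (mseq X) D f (@mboxes _ X)) => //.
by move=> _ [_ [Cs mCs <-] <-]; exact: mf.
Qed.

Lemma measurable_cons :
  measurable_fun setT (fun xs : X * mseq X => xs.1 :: xs.2 : mseq X).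
Proof.
apply: measurable_fun_mseq => // -[|C Cs] mCs.
  by rewrite (_ : _ `&` _ = set0)//; apply/seteqP; split => // -[x s] [].
rewrite (_ : _ `&` _ = C `*` box Cs); last first.
  by apply/seteqP; split => -[x s]/=; [case|].
apply: measurableX; first by apply: mCs; rewrite mem_head.
by apply: measurable_box => D DCs; apply: mCs; rewrite in_cons DCs orbT.
Qed.

Lemma measurable_cat :
  measurable_fun setT (fun st : mseq X * mseq X => st.1 ++ st.2 : mseq X).
Proof.
apply: measurable_fun_mseq => // Cs mCs.
(* The box does not tell where the first list ends, but only the finitely many ranks up to [size Cs]
   are possible. *)
rewrite (_ : _ `&` _ = \bigcup_(k in [set k | (k <= size Cs)%N])
    (box (take k Cs) `*` box (drop k Cs))); last first.
  apply/seteqP; split=> [[s t] [_ /box_cat[sC bs bt]]|]; first by exists (size s).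
  move=> [s t] [k /= kC [/= bs bt]]; split => //; apply/box_cat.
  by rewrite (box_size bs) size_takel.
apply: bigcup_measurable => k _; apply: measurableX; apply: measurable_box => C.
  by move/mem_take; exact: mCs.
by move/mem_drop; exact: mCs.
Qed.

Lemma measurable_behead : measurable_fun setT (behead : mseq X -> mseq X).
Proof.
apply: measurable_fun_mseq => // Cs mCs; rewrite setTI.
(* [behead] fixes the empty list, which therefore also lies in the preimage when [Cs] is empty. *)
rewrite (_ : _ @^-1` _ = box (setT :: Cs) `|` [set s | s = [::] /\ Cs = [::]]).
  apply: measurableU; first apply: measurable_box => C.
    by rewrite in_cons => /orP[/eqP ->//|]; exact: mCs.
  rewrite (_ : mkset _ = [set s | size s = 0%N /\ Cs = [::]]).
    exact: (@measurable_sizeP (fun n => n = 0%N /\ Cs = [::])).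
  by apply/seteqP; split=> [s [-> ->]//|[|x s] []].
apply/seteqP; split => [[|x s]|s []]/=.
- by case: Cs {mCs} => //= _; right.
- by left.
- by case: s => // x s [].
- by move=> [-> ->].
Qed.

Lemma measurable_head (x0 : X) : measurable_fun setT (head x0 : mseq X -> X).
Proof.
move=> _ B mB; rewrite setTI.
(* The empty list is sent to the default [x0], hence the second piece. *)
rewrite (_ : _ @^-1` _ = (\bigcup_n box (B :: nseq n setT)) `|`
    [set s | size s = 0%N /\ B x0]).
  apply: measurableU; last exact: (@measurable_sizeP (fun n => n = 0%N /\ B x0)).
  apply: bigcup_measurable => n _; apply: measurable_box => C.
  by rewrite in_cons => /orP[/eqP ->//|/nseqP[-> _]].
apply/seteqP; split => [[|x s] Bx|s [[n _]|]].
- by right.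
- by left; exists (size s) => //; split => //; exact/boxT.
- by case: s => // x s [].
- by case: s => [[]|x s []].
Qed.

Lemma measurable_nth (x0 : X) (i : nat) :
  measurable_fun setT (fun s : mseq X => nth x0 s i).
Proof.
elim: i => [|i IH].
  by under eq_fun do rewrite nth0; exact: measurable_head.
rewrite (_ : (fun s => _) = (fun s : mseq X => nth x0 s i) \o behead).
  by apply: measurableT_comp => //; exact: measurable_behead.
by apply/funext => s /=; rewrite nth_behead.
Qed.

Lemma eq_measure_mseq (R : realType) (m1 m2 : {measure set (mseq X) -> \bar R}) :
  (forall Cs, (forall C, C \in Cs -> measurable C) ->
    m1 (box Cs) = m2 (box Cs)) ->
  (m1 setT < +oo)%E -> forall A, measurable A -> m1 A = m2 A.
Proof.
move=> m12 m1oo A mA.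
apply: (@measure_unique _ R (mseq X) (@mboxes _ X) (fun n => box (nseq n setT))) => //.
- exact: mboxesI.
- by move=> n; exists (nseq n setT) => // C /nseqP[-> _].
- apply/seteqP; split=> // s _; exists (size s) => //; exact/boxT.
- by move=> _ [Cs mCs <-]; exact: m12.
- move=> n; apply: le_lt_trans m1oo; apply: le_measure => //; rewrite inE//.
  by apply: measurable_box => C /nseqP[-> _].
Qed.

End measurable_lists_maps.

(** * Superposition and iteration of random configurations *)

Section giry_complements.
Context {d : measure_display} {X : measurableType d} {R : realType}.
Local Open Scope ereal_scope.

Lemma giry_int_indic (m : giry X R) (A : set X) : measurable A ->
  giry_int m (EFin \o \1_A) = m A.
Proof. by move=> mA; rewrite /giry_int integral_indic// setIT. Qed.

Lemma giry_int_cst (m : giry X R) (c : \bar R) : m setT = 1 ->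
  giry_int m (fun=> c) = c.
Proof.
by move=> m1; rewrite /giry_int (integral_cst m measurableT c) [X in c * X]m1 mule1.
Qed.

Lemma le_giry_int (m : giry X R) (F G : X -> \bar R) :
  measurable_fun setT F -> measurable_fun setT G -> (forall x, 0 <= F x) ->
  (forall x, F x <= G x) -> giry_int m F <= giry_int m G.
Proof.
by move=> mF mG F0 FG; apply: ge0_le_integral => // x _; exact: (le_trans (F0 x)).
Qed.

Lemma giry_int_ge0 (m : giry X R) (F : X -> \bar R) : (forall x, 0 <= F x) ->
  0 <= giry_int m F.
Proof. by move=> F0; apply: integral_ge0. Qed.

End giry_complements.

Section giry_complements2.
Context {d : measure_display} {X : measurableType d} {R : realType}.
Local Open Scope ereal_scope.

Lemma giry_bindE d' (Y : measurableType d') (m : giry X R) (f : X -> giry Y R)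
    (mf : measurable_fun setT f) (A : set Y) : measurable A ->
  giry_bind m mf A = giry_int m (fun x => f x A).
Proof.
move=> mA; rewrite -(giry_int_indic _ mA) giry_int_bind//; last first.
- by move=> y; rewrite lee_fin.
- exact/measurable_EFinP/measurable_indic.
by apply: eq_integral => x _; rewrite giry_int_indic.
Qed.

Lemma measurable_giry_int_comp d' (Y : measurableType d') (f : X -> giry Y R)
    (F : Y -> \bar R) : measurable_fun setT f -> measurable_fun setT F ->
  (forall y, 0 <= F y) -> measurable_fun setT (fun x => giry_int (f x) F).
Proof.
move=> mf mF F0; apply: (@measurableT_comp _ _ _ _ _ _ (giry_int ^~ F)) => //.
exact: measurable_giry_int.
Qed.

Lemma measurable_giry_ev_comp d' (Y : measurableType d') (f : X -> giry Y R)
    (A : set Y) : measurable_fun setT f -> measurable A ->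
  measurable_fun setT (fun x => f x A).
Proof.
move=> mf mA; apply: (@measurableT_comp _ _ _ _ _ _ (giry_ev ^~ A)) => //.
exact: measurable_giry_ev.
Qed.

End giry_complements2.

Section integral_nat.
Context {R : realType}.
Local Open Scope ereal_scope.

Lemma ge0_integral_nat (m : {measure set nat -> \bar R}) (F : nat -> \bar R) :
  (forall k, 0 <= F k) ->
  \int[m]_k F k = \sum_(0 <= k <oo) F k * m [set k].
Proof.
move=> F0; have -> : [set: nat] = \bigcup_k [set k].
  by apply/seteqP; split=> // k _; exists k.
rewrite ge0_integral_bigcup//; last first.
  by apply/trivIsetP => i j _ _ /eqP ij; apply/seteqP; split=> // k [/= -> /ij].
apply: eq_eseriesr => k _.
rewrite (eq_integral (cst (F k))) ?integral_cst// => x.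
by rewrite inE => ->.
Qed.

End integral_nat.

Section catp.
Context {d : measure_display} {X : measurableType d} {R : realType}.
Local Open Scope ereal_scope.

(** Convolution on the monoid of lists: the law of two independent populations put side by side. *)
Definition catp (m1 m2 : giry (mseq X) R) : giry (mseq X) R :=
  giry_map measurable_cat (giry_prod (m1, m2)).

Lemma measurable_catp d' (Y : measurableType d') (f g : Y -> giry (mseq X) R) :
  measurable_fun setT f -> measurable_fun setT g ->
  measurable_fun setT (fun y => catp (f y) (g y)).
Proof.
move=> mf mg.
apply: (@measurableT_comp _ _ _ _ _ _ (giry_map measurable_cat)) => //.
  exact: measurable_giry_map.
apply: (@measurableT_comp _ _ _ _ _ _ giry_prod) => //.
  exact: measurable_giry_prod.
exact: measurable_fun_pair.
Qed.

Lemma giry_int_catp (m1 m2 : giry (mseq X) R) (F : mseq X -> \bar R) :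
  measurable_fun setT F -> (forall s, 0 <= F s) ->
  giry_int (catp m1 m2) F =
  giry_int m1 (fun s => giry_int m2 (fun t => F (s ++ t))).
Proof.
move=> mF F0; rewrite giry_int_map// giry_int_prod1//.
  by apply: measurableT_comp => //; exact: measurable_cat.
by move=> x; exact: F0.
Qed.

Lemma catp_setT (m1 m2 : giry (mseq X) R) :
  m1 setT = 1 -> m2 setT = 1 -> catp m1 m2 setT = 1.
Proof.
move=> m1T m2T; rewrite -(giry_int_indic (catp _ _))// indicT.
rewrite giry_int_catp//; last exact/measurable_EFinP.
by rewrite (giry_int_cst (giry_int m2 (fun=> 1)))// giry_int_cst.
Qed.

Lemma measurable_int_cat (m : giry (mseq X) R) (F : mseq X -> \bar R) :
  measurable_fun setT F -> (forall s, 0 <= F s) ->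
  measurable_fun setT (fun s : mseq X => giry_int m (fun t => F (s ++ t))).
Proof.
move=> mF F0.
apply: (measurable_fun_fubini_tonelli_F
  (fun st : mseq X * mseq X => F (st.1 ++ st.2))) => //.
by apply: (measurableT_comp mF); exact: measurable_cat.
Qed.

Lemma catp_box (m1 m2 : giry (mseq X) R) (Cs : seq (set X)) :
  (forall C, C \in Cs -> measurable C) ->
  catp m1 m2 (box Cs) =
  \sum_(0 <= k < (size Cs).+1) m1 (box (take k Cs)) * m2 (box (drop k Cs)).
Proof.
move=> mCs.
have mt k : measurable (box (take k Cs) : set (mseq X)).
  by apply: measurable_box => C /mem_take; exact: mCs.
have md k : measurable (box (drop k Cs) : set (mseq X)).
  by apply: measurable_box => C /mem_drop; exact: mCs.
rewrite -(giry_int_indic (catp _ _)); last exact: measurable_box.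
rewrite giry_int_catp; last 2 first.
- by apply/measurable_EFinP; apply: measurable_indic; exact: measurable_box.
- by move=> s; rewrite lee_fin.
have indic_boxE (s t : mseq X) : (\1_(box Cs) (s ++ t))%:E =
    \sum_(0 <= k < (size Cs).+1)
      (\1_(box (take k Cs)) s)%:E * (\1_(box (drop k Cs)) t)%:E :> \bar R.
  (* Only the cut at [size s] contributes: a box of another length rejects [s]. The indicator of the
     concatenation is thus a sum of products, which independence integrates factor by factor. *)
  have dec (k : nat) : k != size s -> (k <= size Cs)%N ->
      (\1_(box (take k Cs)) s)%:E * (\1_(box (drop k Cs)) t)%:E = 0 :> \bar R.
    move=> ks kC.
    suff sN : (s \in box (take k Cs)) = false by rewrite indicE sN mul0e.
    apply/negbTE/negP; rewrite inE => /box_size sE.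
    by rewrite sE size_takel// eqxx in ks.
  have [sC|sC] := leqP (size s) (size Cs); last first.
    rewrite big1_seq => [|k]; last first.
      rewrite /= mem_index_iota ltnS => /= kC; apply: dec => //.
      by rewrite ltn_eqF// (leq_ltn_trans kC).
    suff sN : (s ++ t \in box Cs) = false by rewrite indicE sN.
    by apply/negbTE/negP; rewrite inE => /box_cat[]; rewrite leqNgt sC.
  rewrite (@big_cat_nat _ _ _ (size s)) //=; last exact: leqW.
  rewrite [X in _ + X]big_ltn// big1_seq ?add0e => [|k]; last first.
    rewrite /= mem_index_iota => /= ks; apply: dec; first by rewrite ltn_eqF.
    exact: leq_trans (ltnW ks) sC.
  rewrite big1_seq ?adde0 => [|k]; last first.
    rewrite /= mem_index_iota => /andP[ks kC]; apply: dec => //.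
    by rewrite gtn_eqF.
  rewrite -EFinM !indicE -natrM mulnb; congr (_%:R%:E); congr nat_of_bool.
  apply/idP/andP; rewrite !inE; first by move=> /box_cat[].
  by move=> [? ?]; exact/box_cat.
transitivity (giry_int m1 (fun s : mseq X => \sum_(0 <= k < (size Cs).+1)
    m2 (box (drop k Cs)) * (\1_(box (take k Cs)) s)%:E)).
  apply: eq_integral => s _; rewrite /giry_int.
  rewrite (eq_integral (fun t : mseq X => \sum_(0 <= k < (size Cs).+1)
    (\1_(box (take k Cs)) s)%:E * (\1_(box (drop k Cs)) t)%:E)); last first.
    by move=> t _; exact: indic_boxE.
  rewrite ge0_integral_sum//; last first.
    move=> k; apply: measurable_funeM.
    by apply/measurable_EFinP; exact: measurable_indic.
  apply: eq_bigr => k _; rewrite ge0_integralZl//.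
  - by rewrite integral_indic// setIT muleC.
  - by apply/measurable_EFinP; exact: measurable_indic.
rewrite /giry_int ge0_integral_sum//; last 2 first.
- move=> k; apply: measurable_funeM.
  by apply/measurable_EFinP; exact: measurable_indic.
- by move=> k s _; rewrite mule_ge0.
apply: eq_bigr => k _; rewrite ge0_integralZl//.
- by rewrite integral_indic// setIT muleC.
- exact/measurable_EFinP/measurable_indic.
Qed.

End catp.

Section offspring_kernel.
Context {d : measure_display} {X : measurableType d} {R : realType}.
Variables (p : probability nat R) (P : X -> giry X R).
Hypothesis mP : measurable_fun setT P.
Hypothesis P1 : forall x, P x setT = 1%E.
Local Open Scope ereal_scope.

Fixpoint iid (k : nat) (x : X) : giry (mseq X) R :=
  if k is k'.+1 then giry_map measurable_cons (giry_prod (P x, iid k' x))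
  else giry_ret ([::] : mseq X).

Lemma measurable_iid k : measurable_fun setT (iid k).
Proof.
elim: k => [|k IH]; first exact: measurable_cst.
apply: (@measurableT_comp _ _ _ _ _ _ (giry_map measurable_cons)) => //.
  exact: measurable_giry_map.
apply: (@measurableT_comp _ _ _ _ _ _ giry_prod) => //.
  exact: measurable_giry_prod.
exact: measurable_fun_pair.
Qed.

Lemma giry_int_iidS k x (F : mseq X -> \bar R) :
  measurable_fun setT F -> (forall s, 0 <= F s) ->
  giry_int (iid k.+1 x) F =
  giry_int (P x) (fun y => giry_int (iid k x) (fun s => F (y :: s))).
Proof.
move=> mF F0; rewrite giry_int_map// giry_int_prod1//.
  by apply: measurableT_comp => //; exact: measurable_cons.
by move=> ys; exact: F0.
Qed.

Lemma iid_setT k x : iid k x setT = 1.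
Proof.
elim: k => [|k IH]; first by rewrite /= diracT.
rewrite -(giry_int_indic (iid _ _))// indicT giry_int_iidS//; last first.
  exact/measurable_EFinP.
by rewrite (giry_int_cst (giry_int (iid k x) (fun=> 1)))// giry_int_cst.
Qed.

Lemma iid_box k x (Cs : seq (set X)) : (forall C, C \in Cs -> measurable C) ->
  iid k x (box Cs) = (k == size Cs)%:R%:E * \prod_(C <- Cs) P x C.
Proof.
elim: k Cs => [|k IH] [|C Cs] mCs.
- by rewrite big_nil mule1 /= diracE mem_set.
- by rewrite /= mul0e diracE memNset.
- rewrite mul0e; transitivity ((P x \x iid k x) set0); last exact: measure0.
  by congr ((P x \x iid k x) _); apply/seteqP; split=> // -[].
have mC : measurable C by apply: mCs; rewrite mem_head.
have mCs' D : D \in Cs -> measurable D.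
  by move=> DCs; apply: mCs; rewrite in_cons DCs orbT.
rewrite big_cons /= eqSS muleCA -IH//.
transitivity ((P x \x iid k x) (C `*` box Cs)).
  by congr ((P x \x iid k x) _); apply/seteqP; split=> -[y s].
by rewrite product_measure1E//; exact: measurable_box.
Qed.

Lemma measurable_nat_iid x : measurable_fun setT (iid ^~ x : nat -> _).
Proof. by []. Qed.

(* The law of the positions of the children of a particle at [x], listed in
   birth order. *)
Definition litter (x : X) : giry (mseq X) R :=
  giry_bind p (measurable_nat_iid x).

Lemma giry_int_litter x (F : mseq X -> \bar R) :
  measurable_fun setT F -> (forall s, 0 <= F s) ->
  giry_int (litter x) F =
  \sum_(0 <= k <oo) giry_int (iid k x) F * p [set k].
Proof.
move=> mF F0; rewrite giry_int_bind// /giry_int ge0_integral_nat//.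
by move=> k; exact: giry_int_ge0.
Qed.

Lemma litterE x A : measurable A ->
  litter x A = \sum_(0 <= k <oo) iid k x A * p [set k].
Proof.
move=> mA; rewrite -(giry_int_indic _ mA) giry_int_litter//; last 2 first.
- by apply/measurable_EFinP; exact: measurable_indic.
- by move=> s; rewrite lee_fin.
by apply: eq_eseriesr => k _; rewrite giry_int_indic.
Qed.

Lemma measurable_litter : measurable_fun setT litter.
Proof.
apply: measurable_giry_codensity => // A mA.
under eq_fun do rewrite litterE//.
apply: ge0_emeasurable_sum => [k x _ _|k _]; first by rewrite mule_ge0.
apply: emeasurable_funM => //.
by apply: measurable_giry_ev_comp => //; exact: measurable_iid.
Qed.

Lemma litter_setT x : litter x setT = 1.
Proof.
rewrite litterE//; under eq_eseriesr do rewrite iid_setT.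
transitivity (\int[p]_k (cst 1 k)).
  by rewrite ge0_integral_nat.
by rewrite integral_cst// mul1e; exact: probability_setT.
Qed.

Lemma litter_box x (Cs : seq (set X)) : (forall C, C \in Cs -> measurable C) ->
  litter x (box Cs) = p [set size Cs] * \prod_(C <- Cs) P x C.
Proof.
move=> mCs; rewrite litterE; last exact: measurable_box.
under eq_eseriesr do rewrite iid_box//.
have ge0 k : 0 <= (k == size Cs)%:R%:E * (\prod_(C <- Cs) P x C) * p [set k].
  by rewrite -iid_box// mule_ge0.
rewrite (@nneseriesD1 _ _ (size Cs)) // eqxx mul1e muleC.
rewrite eseries0 ?adde0// => k _ /negbTE ->.
by rewrite !mul0e.
Qed.

End offspring_kernel.

Section generation_kernel.
Context {d : measure_display} {X : measurableType d} {R : realType}.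
Variable L : X -> giry (mseq X) R.
Hypothesis mL : measurable_fun setT L.
Hypothesis L1 : forall x, L x setT = 1%E.
Local Open Scope ereal_scope.

(** Transition kernel from one generation to the next, children being listed in the order of their
    parents. *)
Fixpoint breed (s : seq X) : giry (mseq X) R :=
  if s is x :: s' then catp (L x) (breed s') else giry_ret ([::] : mseq X).

(** The recursion runs on the argument itself, so it is first truncated: the version on [take n s]
    is measurable by induction on n through [head] and [behead], and it agrees with [breed] on lists
    of size n. *)
Lemma measurable_breed : measurable_fun setT (breed : mseq X -> _).
Proof.
have mtake n : measurable_fun setT (fun s : mseq X => breed (take n s)).
  elim: n => [|n IH].
    rewrite (_ : (fun s => _) = cst (giry_ret ([::] : mseq X))).
      exact: measurable_cst.
    by apply/funext => s; rewrite take0.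
  rewrite (_ : (fun s => _) = (fun s : mseq X =>
    if (0 < size s)%N then catp (L (head point s)) (breed (take n (behead s)))
    else giry_ret ([::] : mseq X))); last by apply/funext => -[|x s].
  apply: measurable_fun_ifT.
  - apply: (measurable_fun_bool true); rewrite setTI.
    exact: (measurable_sizeP (fun k => (0 < k)%N = true)).
  - apply: measurable_catp.
      by apply: measurableT_comp => //; exact: measurable_head.
    apply: (@measurableT_comp _ _ _ _ _ _ (fun s : mseq X => breed (take n s))) => //.
    exact: measurable_behead.
  - exact: measurable_cst.
have -> : [set: mseq X] = \bigcup_n [set s | size s = n].
  by apply/seteqP; split=> // s _; exists (size s).
apply/measurable_fun_bigcup; first by move=> n; exact: measurable_size.
move=> n; apply: (eq_measurable_fun (fun s : mseq X => breed (take n s))).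
  by move=> s; rewrite inE => /= <-; rewrite take_size.
apply: measurable_funS (mtake n) => //.
Qed.

Lemma breed_setT s : breed s setT = 1.
Proof. by elim: s => [|x s IH] /=; [rewrite diracT|exact: catp_setT]. Qed.

Lemma measurable_cat1 (s : seq X) :
  measurable_fun setT (fun t : mseq X => s ++ t : mseq X).
Proof.
rewrite (_ : (fun t => _) = (fun st : mseq X * mseq X => st.1 ++ st.2 : mseq X)
  \o pair (s : mseq X))//.
by apply: measurableT_comp; [exact: measurable_cat|exact: pair1_measurable].
Qed.

Lemma giry_int_breed1 x (F : mseq X -> \bar R) :
  measurable_fun setT F -> (forall s, 0 <= F s) ->
  giry_int (breed [:: x]) F = giry_int (L x) F.
Proof.
move=> mF F0; rewrite giry_int_catp//; apply: eq_integral => s _.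
rewrite giry_int_ret ?cats0//.
exact: measurableT_comp mF (measurable_cat1 s).
Qed.

Lemma giry_int_breed_cat s t (F : mseq X -> \bar R) :
  measurable_fun setT F -> (forall s, 0 <= F s) ->
  giry_int (breed (s ++ t)) F =
  giry_int (breed s) (fun s' => giry_int (breed t) (fun t' => F (s' ++ t'))).
Proof.
elim: s F => [|x s IH] F mF F0 /=.
  by rewrite giry_int_ret//; exact: measurable_int_cat.
rewrite !giry_int_catp//; last 2 first.
- exact: measurable_int_cat.
- by move=> u; exact: giry_int_ge0.
apply: eq_integral => u _; rewrite IH//.
- apply: eq_integral => v _; apply: eq_integral => w _.
  by rewrite catA.
- exact: measurableT_comp mF (measurable_cat1 u).
Qed.

Fixpoint breedn (n : nat) (s : seq X) : giry (mseq X) R :=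
  if n is n'.+1 then giry_bind (breedn n' s) measurable_breed
  else giry_ret (s : mseq X).

Lemma measurable_breedn n : measurable_fun setT (breedn n : mseq X -> _).
Proof.
elim: n => [|n IH]; first exact: measurable_giry_ret.
apply: (@measurableT_comp _ _ _ _ _ _ (fun mu => giry_bind mu measurable_breed)) => //.
exact: measurable_giry_bind.
Qed.

Lemma measurable_giry_int_breedn n (F : mseq X -> \bar R) :
  measurable_fun setT F -> (forall s, 0 <= F s) ->
  measurable_fun setT (fun s : mseq X => giry_int (breedn n s) F).
Proof.
by move=> mF F0; apply: measurable_giry_int_comp => //; exact: measurable_breedn.
Qed.

Lemma measurable_giry_int_breed (F : mseq X -> \bar R) :
  measurable_fun setT F -> (forall s, 0 <= F s) ->
  measurable_fun setT (fun s : mseq X => giry_int (breed s) F).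
Proof.
by move=> mF F0; apply: measurable_giry_int_comp => //; exact: measurable_breed.
Qed.

Lemma breedn_setT n s : breedn n s setT = 1.
Proof.
elim: n => [|n IH]; first by rewrite /= diracT.
rewrite (giry_bindE (breedn n s) measurable_breed)//.
under [X in giry_int _ X]eq_fun do rewrite breed_setT.
exact: giry_int_cst.
Qed.

Lemma giry_int_breednSr n s (F : mseq X -> \bar R) :
  measurable_fun setT F -> (forall s, 0 <= F s) ->
  giry_int (breedn n.+1 s) F =
  giry_int (breedn n s) (fun t => giry_int (breed t) F).
Proof. by move=> mF F0; exact: giry_int_bind. Qed.

(** [breedn] peels off the last generation, whereas the recursion for v_n conditions on the first;
    this lemma passes from one to the other. *)
Lemma giry_int_breednS n s (F : mseq X -> \bar R) :
  measurable_fun setT F -> (forall s, 0 <= F s) ->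
  giry_int (breedn n.+1 s) F =
  giry_int (breed s) (fun t => giry_int (breedn n t) F).
Proof.
elim: n F => [|n IH] F mF F0.
  rewrite giry_int_breednSr// giry_int_ret; last exact: measurable_giry_int_breed.
  by apply: eq_integral => t _; rewrite giry_int_ret.
rewrite giry_int_breednSr// IH; last 2 first.
- exact: measurable_giry_int_breed.
- by move=> t; exact: giry_int_ge0.
by apply: eq_integral => t _; rewrite giry_int_breednSr.
Qed.

(** Branching property over n generations. The one-step version [giry_int_breed_cat] propagates by
    induction, Fubini exchanging the last generation on one side with the earlier ones on the
    other. *)
Lemma giry_int_breedn_cat n s t (F : mseq X -> \bar R) :
  measurable_fun setT F -> (forall s, 0 <= F s) ->
  giry_int (breedn n (s ++ t)) F =
  giry_int (breedn n s) (fun s' => giry_int (breedn n t) (fun t' => F (s' ++ t'))).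
Proof.
elim: n F => [|n IH] F mF F0.
  rewrite !giry_int_ret//; last exact: measurable_int_cat.
  exact: measurableT_comp mF (measurable_cat1 s).
have mFc u : measurable_fun setT (fun t' : mseq X => F (u ++ t')).
  exact: measurableT_comp mF (measurable_cat1 u).
rewrite giry_int_breednSr// IH; last 2 first.
- exact: measurable_giry_int_breed.
- by move=> u; exact: giry_int_ge0.
rewrite giry_int_breednSr//; last 2 first.
- exact: measurable_int_cat.
- by move=> u; exact: giry_int_ge0.
apply: eq_integral => u _.
under [RHS]eq_integral do rewrite giry_int_breednSr//.
(* [vw.1] is the last generation on the side of [s], [vw.2] the last but one on the side of [t]; the
   two members of the goal integrate [H] in opposite orders. *)
pose H (vw : mseq X * mseq X) :=
  giry_int (breed vw.2) (fun t' => F (vw.1 ++ t')).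
have H0 vw : 0 <= H vw by exact: giry_int_ge0.
have mH : measurable_fun setT H.
  (* Joint measurability comes from writing the integral against a [catp] with a Dirac factor. *)
  rewrite (_ : H = fun vw => giry_int (catp (giry_ret vw.1) (breed vw.2)) F).
    apply: measurable_giry_int_comp => //; apply: measurable_catp.
      by apply: measurableT_comp => //; exact: measurable_giry_ret.
    by apply: measurableT_comp => //; exact: measurable_breed.
  apply/funext => vw; rewrite giry_int_catp// giry_int_ret//.
  exact: measurable_int_cat.
transitivity (giry_int (breedn n t) (fun w => giry_int (breed u) (fun v => H (v, w)))).
  by apply: eq_integral => v _; rewrite giry_int_breed_cat.
by rewrite -(giry_int_prod2 _ _ mH H0) (giry_int_prod1 _ _ mH H0).
Qed.

Lemma breedn_cons n x s A : measurable A -> breedn n (x :: s) A =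
  catp (breedn n [:: x]) (breedn n s) A.
Proof.
move=> mA; have mF : measurable_fun setT (EFin \o \1_A : mseq X -> \bar R).
  by apply/measurable_EFinP; exact: measurable_indic.
have F0 t : 0 <= (EFin \o \1_A : mseq X -> \bar R) t by rewrite lee_fin.
rewrite -(giry_int_indic _ mA) (giry_int_breedn_cat n [:: x] s mF F0).
by rewrite -(giry_int_catp _ _ mF F0) giry_int_indic.
Qed.

End generation_kernel.

Section measurable_sum_list.
Context {d : measure_display} {X : measurableType d} {R : realType}.
Local Open Scope ereal_scope.

Lemma measurable_sum_list (h : X -> \bar R) :
  measurable_fun setT h -> measurable_fun setT (fun s : mseq X => \sum_(y <- s) h y).
Proof.
move=> mh; have -> : [set: mseq X] = \bigcup_n [set s | size s = n].
  by apply/seteqP; split=> // s _; exists (size s).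
apply/measurable_fun_bigcup; first by move=> n; exact: measurable_size.
move=> n; apply: (eq_measurable_fun
    (fun s : mseq X => \sum_(i < n) h (nth point s i))).
  move=> s; rewrite inE => /= <-.
  by rewrite [RHS](big_nth point) big_mkord.
apply: emeasurable_sum => i; apply: measurable_funTS.
by apply: measurableT_comp => //; exact: measurable_nth.
Qed.

End measurable_sum_list.

Section litter_moments.
Context {d : measure_display} {X : measurableType d} {R : realType}.
Variables (p : probability nat R) (P : X -> giry X R).
Hypothesis mP : measurable_fun setT P.
Hypothesis P1 : forall x, P x setT = 1%E.
Local Open Scope ereal_scope.
Notation L := (litter p P).
Notation iid := (iid P).

Lemma measurable_fun_size (g : nat -> \bar R) :
  measurable_fun setT (fun s : mseq X => g (size s)).
Proof.
by move=> _ Y mY; rewrite setTI; exact: (measurable_sizeP (fun k => Y (g k))).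
Qed.

Lemma giry_int_iid_size k x (g : nat -> \bar R) : (forall k, 0 <= g k) ->
  giry_int (iid k x) (fun s : mseq X => g (size s)) = g k.
Proof.
elim: k g => [|k IH] g g0.
  by rewrite giry_int_ret//; exact: measurable_fun_size.
rewrite giry_int_iidS//; last exact: measurable_fun_size.
under [X in giry_int _ X]eq_fun do rewrite (IH (fun k => g k.+1))//.
exact: giry_int_cst.
Qed.

Lemma giry_int_litter_size x (g : nat -> \bar R) : (forall k, 0 <= g k) ->
  giry_int (L x) (fun s : mseq X => g (size s)) =
  \sum_(0 <= k <oo) g k * p [set k].
Proof.
move=> g0; rewrite giry_int_litter//; last exact: measurable_fun_size.
by apply: eq_eseriesr => k _; rewrite giry_int_iid_size.
Qed.

Lemma giry_int_iid_sum k x (h : X -> \bar R) :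
  measurable_fun setT h -> (forall y, 0 <= h y) ->
  giry_int (iid k x) (fun s : mseq X => \sum_(y <- s) h y) =
  k%:R%:E * giry_int (P x) h.
Proof.
move=> mh h0; have ms := measurable_sum_list mh.
have s0 (s : mseq X) : 0 <= \sum_(y <- s) h y by exact: sume_ge0.
elim: k => [|k IH].
  by rewrite giry_int_ret// big_nil mul0e.
rewrite giry_int_iidS//.
transitivity (giry_int (P x) (fun y => h y + k%:R%:E * giry_int (P x) h)).
  apply: eq_integral => y _; rewrite -IH.
  rewrite /giry_int; under eq_integral do rewrite big_cons.
  rewrite ge0_integralD//; congr (_ + _).
  by rewrite -[LHS]/(giry_int _ (fun=> h y)) giry_int_cst// iid_setT.
have c0 : 0 <= k%:R%:E * giry_int (P x) h.
  by rewrite mule_ge0 ?lee_fin//; exact: giry_int_ge0.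
rewrite /giry_int ge0_integralD//.
rewrite [X in _ + X](_ : _ = k%:R%:E * giry_int (P x) h); last first.
  by rewrite -[LHS]/(giry_int _ (fun=> k%:R%:E * giry_int (P x) h)) giry_int_cst.
rewrite -/(giry_int (P x) h) -natr1 EFinD addrC ge0_muleDl ?mul1e ?lee_fin//.
Qed.

(** Many-to-one formula for one generation: given its size, a litter has an expected sum
    proportional to that size. It produces the term m P v_n of the recursion. *)
Lemma giry_int_litter_sum x (h : X -> \bar R) :
  measurable_fun setT h -> (forall y, 0 <= h y) ->
  giry_int (P x) h \is a fin_num ->
  giry_int (L x) (fun s : mseq X => \sum_(y <- s) h y) =
  offspring_mean p * giry_int (P x) h.
Proof.
move=> mh h0 hfin; rewrite giry_int_litter//; last 2 first.
- exact: measurable_sum_list.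
- by move=> s; exact: sume_ge0.
under eq_eseriesr do rewrite giry_int_iid_sum//.
rewrite muleC /offspring_mean -(fineK hfin) -nneseriesZl//; last first.
  by move=> k _; rewrite mule_ge0 ?lee_fin.
by apply: eq_eseriesr => k _; rewrite (fineK hfin) muleCA muleA.
Qed.

End litter_moments.

Section superposition.
Context {d : measure_display} {X : measurableType d} {R : realType}.
Local Open Scope ereal_scope.

Definition alive : set (seq X) := [set s | (0 < size s)%N].

Lemma measurable_alive : measurable (alive : set (mseq X)).
Proof. exact: (measurable_sizeP (fun k => (0 < k)%N)). Qed.

Variables (m1 m2 : giry (mseq X) R) (D : set (mseq X)).
Hypotheses (m1T : m1 setT = 1) (m2T : m2 setT = 1).
Hypotheses (mD : measurable D) (D0 : ~ D [::]).

Let m := m1 \x m2.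
Let catD : set (mseq X * mseq X) := [set st | D (st.1 ++ st.2)].

Let mcatD : measurable catD.
Proof. by rewrite -[catD]setTI; exact: measurable_cat. Qed.

Let D_alive s : D s -> alive s. Proof. by case: s. Qed.

Let mn : measurable ([set [::]] : set (mseq X)).
Proof.
rewrite (_ : [set [::]] = [set s | size s = 0%N]); first exact: measurable_size.
by apply/seteqP; split=> [s ->//|[]].
Qed.

(** If the concatenation is in [D], either one of the lists is empty and the other is in [D], or
    both are nonempty. *)
Lemma catp_le : catp m1 m2 D <= m1 D + m2 D + m1 alive * m2 alive.
Proof.
have ma := measurable_alive.
rewrite -[leLHS]/(m catD).
have -> : m1 D = m (D `*` setT) by rewrite /m product_measure1E// [X in _ * X]m2T mule1.
have -> : m2 D = m (setT `*` D) by rewrite /m product_measure1E// [X in X * _]m1T mul1e.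
rewrite -(product_measure1E m1 m2 ma ma) -/m.
apply: (@le_trans _ _ (m (D `*` setT `|` setT `*` D `|` alive `*` alive))).
  apply: le_measure; rewrite ?inE//.
    by apply: measurableU; [apply: measurableU|]; exact: measurableX.
  move=> [s t]; rewrite /catD/=; case: s => [|x s]; first by left; right.
  by case: t => [|y t]; [rewrite cats0; left; left|right].
apply: (le_trans (measureU2 _ _ _)).
- by apply: measurableU; exact: measurableX.
- exact: measurableX.
- by rewrite leeD2r// measureU2//; exact: measurableX.
Qed.

(** The events that one list is in [D] and the other is empty are disjoint, because [D] misses the
    empty list, and both put the concatenation in [D]. Each term on the left exceeds its event by at
    most the probability that both lists are nonempty, whence the factor 2. *)
Lemma catp_ge : m1 D + m2 D <= catp m1 m2 D + 2%:E * (m1 alive * m2 alive).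
Proof.
have ma := measurable_alive.
rewrite -[X in _ <= X + _]/(m catD).
have -> : m1 D = m (D `*` setT) by rewrite /m product_measure1E// [X in _ * X]m2T mule1.
have -> : m2 D = m (setT `*` D) by rewrite /m product_measure1E// [X in X * _]m1T mul1e.
rewrite -(product_measure1E m1 m2 ma ma) -/m.
have le1 : m (D `*` setT) <= m (D `*` [set [::]]) + m (alive `*` alive).
  apply: (@le_trans _ _ (m (D `*` [set [::]] `|` alive `*` alive))).
    apply: le_measure; rewrite ?inE//; first exact: measurableX.
      by apply: measurableU; exact: measurableX.
    move=> [s t] /= [Ds _]; case: t => [|y t]; first by left.
    by right; split => //; exact: D_alive.
  by rewrite measureU2//; exact: measurableX.
have le2 : m (setT `*` D) <= m ([set [::]] `*` D) + m (alive `*` alive).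
  apply: (@le_trans _ _ (m ([set [::]] `*` D `|` alive `*` alive))).
    apply: le_measure; rewrite ?inE//; first exact: measurableX.
      by apply: measurableU; exact: measurableX.
    move=> [s t] /= [_ Dt]; case: s => [|y s]; first by left.
    by right; split => //; exact: D_alive.
  by rewrite measureU2//; exact: measurableX.
apply: (le_trans (leeD le1 le2)).
rewrite addeACA mule_natl mule2n leeD2r// -measureU//; last 3 first.
- exact: measurableX.
- exact: measurableX.
- apply/seteqP; split => // -[s t] /= [[Ds t0] [s0 _]].
  by rewrite s0 in Ds; exact: D0.
apply: le_measure; rewrite ?inE//.
  by apply: measurableU; exact: measurableX.
by move=> [s t]; rewrite /catD /= => -[[Ds ->]|[-> Dt]]; rewrite ?cats0.
Qed.

Lemma catp_alive : catp m1 m2 alive <= m1 alive + m2 alive.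
Proof.
have ma := measurable_alive.
have -> : m1 alive = m (alive `*` setT).
  by rewrite /m product_measure1E// [X in _ * X]m2T mule1.
have -> : m2 alive = m (setT `*` alive).
  by rewrite /m product_measure1E// [X in X * _]m1T mul1e.
apply: (@le_trans _ _ (m (alive `*` setT `|` setT `*` alive))); last first.
  by rewrite measureU2//; exact: measurableX.
rewrite -[leLHS]/(m [set st | alive (st.1 ++ st.2)]).
apply: le_measure; rewrite ?inE//.
- by rewrite -[X in measurable X]setTI; exact: measurable_cat.
- by apply: measurableU; exact: measurableX.
- by move=> [s t]; rewrite /alive /= size_cat addn_gt0 => /orP[]; [left|right].
Qed.

Lemma catp_alive_ge : m1 alive <= catp m1 m2 alive.
Proof.
have ma := measurable_alive.
rewrite -[leRHS]/(m [set st | alive (st.1 ++ st.2)]).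
have -> : m1 alive = m (alive `*` setT).
  by rewrite /m product_measure1E// [X in _ * X]m2T mule1.
apply: le_measure; rewrite ?inE//; first exact: measurableX.
- by rewrite -[X in measurable X]setTI; exact: measurable_cat.
- by move=> [s t] [sa _]; rewrite /alive /= size_cat addn_gt0 sa.
Qed.

End superposition.

(** * First-step estimates *)

Section population.
Context {d : measure_display} {X : measurableType d} {R : realType}.
Variables (p : probability nat R) (P : X -> giry X R).
Hypothesis mP : measurable_fun setT P.
Hypothesis P1 : forall x, P x setT = 1%E.
Local Open Scope ereal_scope.
Notation L := (litter p P).
Notation mL := (measurable_litter p mP).
Notation Z := (breedn mL).
Let L1 x : L x setT = 1 := litter_setT p P1 x.

(** The size of a litter does not depend on the position of the parent, so population sizes form a
    Galton-Watson process. [g] has to be general because the first litter shifts it by its own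
    size. *)
Lemma giry_int_breed_size s t (g : nat -> \bar R) : (forall k, 0 <= g k) ->
  size s = size t ->
  giry_int (breed L s) (fun u : mseq X => g (size u)) =
  giry_int (breed L t) (fun u : mseq X => g (size u)).
Proof.
move=> + st; elim: s t st g => [|x s IH] [|y t]; [by []|by []|by []|move=> st g g0].
rewrite -[breed L (x :: s)]/(catp _ _) -[breed L (y :: t)]/(catp _ _).
rewrite !giry_int_catp; try by [exact: measurable_fun_size|].
pose g' k := giry_int (breed L s) (fun u : mseq X => g (k + size u)%N).
have g'E k : g' k = giry_int (breed L t) (fun u : mseq X => g (k + size u)%N).
  by apply: (IH t _ (fun j => g (k + j)%N)); [case: st|move=> j; exact: g0].
transitivity (giry_int (L x) (fun u : mseq X => g' (size u))).
  by apply: eq_integral => u _; apply: eq_integral => v _; rewrite size_cat.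
transitivity (giry_int (L y) (fun u : mseq X => g' (size u))).
  by rewrite !giry_int_litter_size// => k; exact: giry_int_ge0.
apply: eq_integral => u _; rewrite g'E.
by apply: eq_integral => v _; rewrite size_cat.
Qed.

Lemma giry_int_breedn_size n s t (g : nat -> \bar R) : (forall k, 0 <= g k) ->
  size s = size t ->
  giry_int (Z n s) (fun u : mseq X => g (size u)) =
  giry_int (Z n t) (fun u : mseq X => g (size u)).
Proof.
move=> + st; elim: n g => [|n IH] g g0.
  by rewrite !giry_int_ret ?st//; exact: measurable_fun_size.
rewrite !giry_int_breednSr//; try exact: measurable_fun_size.
pose g' k := giry_int (breed L (nseq k point)) (fun u : mseq X => g (size u)).
have gg' (u : mseq X) :
    giry_int (breed L u) (fun u : mseq X => g (size u)) = g' (size u).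
  by apply: giry_int_breed_size => //; rewrite size_nseq.
transitivity (giry_int (Z n s) (fun u : mseq X => g' (size u))).
  by apply: eq_integral => u _; exact: gg'.
rewrite IH => [|k]; last exact: giry_int_ge0.
by apply: eq_integral => u _; rewrite gg'.
Qed.

Lemma breedn_alive_size n s t : size s = size t -> Z n s alive = Z n t alive.
Proof.
move=> st; have aE u : Z n u alive =
    giry_int (Z n u) (fun v : mseq X => (0 < size v)%:R%:E).
  rewrite -giry_int_indic; last exact: measurable_alive.
  apply: eq_integral => v _ /=; rewrite indicE; congr (_%:R%:E).
  by congr nat_of_bool; apply/idP/idP; rewrite inE.
by rewrite !aE; apply: (giry_int_breedn_size _ (g := fun k => (0 < k)%:R%:E)).
Qed.

Lemma breedn_nil n (D : set (mseq X)) : measurable D -> ~ D [::] -> Z n [::] D = 0.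
Proof.
move=> mD D0; suff h (F : mseq X -> \bar R) : measurable_fun setT F ->
    (forall s, 0 <= F s) -> giry_int (Z n [::]) F = F [::].
  rewrite -(giry_int_indic _ mD) h//= ?indicE ?memNset//.
  by apply/measurable_EFinP; exact: measurable_indic.
move=> mF F0; elim: n F mF F0 => [|n IH] F mF F0; first by rewrite giry_int_ret.
rewrite giry_int_breednSr// IH.
- by rewrite giry_int_ret.
- exact: (measurable_giry_int_breed mL).
- by move=> u; exact: giry_int_ge0.
Qed.

(** q_n of the overview. Starting from [point] is no restriction, see [survE]. *)
Definition surv n : R := fine (Z n [:: point] alive).

Lemma breedn_le1 n s (D : set (mseq X)) : measurable D -> Z n s D <= 1.
Proof.
move=> mD; rewrite -(breedn_setT mL L1 n s); apply: le_measure; rewrite ?inE//.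
Qed.

Lemma breedn_fin n s (D : set (mseq X)) : measurable D -> Z n s D \is a fin_num.
Proof.
move=> mD; rewrite ge0_fin_numE//.
by apply: le_lt_trans (breedn_le1 _ _ mD) _; exact: ltry.
Qed.

Lemma survE n x : Z n [:: x] alive = (surv n)%:E.
Proof.
rewrite (@breedn_alive_size _ _ [:: point])// /surv fineK//.
by apply: breedn_fin; exact: measurable_alive.
Qed.

Lemma surv_ge0 n : (0 <= surv n)%R.
Proof. exact: fine_ge0. Qed.

Lemma surv_le1 n : (surv n <= 1)%R.
Proof. by rewrite -lee_fin -(survE n point) breedn_le1//; exact: measurable_alive. Qed.

Lemma breedn_alive_le n s : Z n s alive <= ((size s)%:R * surv n)%:E.
Proof.
have ma := @measurable_alive _ X.
elim: s => [|x s IH]; first by rewrite breedn_nil// mul0r.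
rewrite breedn_cons//; apply: (le_trans (catp_alive _ _)).
- exact: breedn_setT.
- exact: breedn_setT.
have -> : ((size (x :: s))%:R * surv n)%:E =
    (surv n)%:E + ((size s)%:R * surv n)%:E.
  by rewrite -EFinD -[size (x :: s)]/(size s).+1 -natr1 mulrDl mul1r addrC.
by rewrite survE leeD2l.
Qed.

Section one_set.
Variable D : set (mseq X).
Hypotheses (mD : measurable D) (D0 : ~ D [::]).

Let D_alive : D `<=` alive. Proof. by case. Qed.

Lemma breedn_le_surv n x : Z n [:: x] D <= (surv n)%:E.
Proof.
rewrite -(survE n x); apply: le_measure; rewrite ?inE//.
exact: measurable_alive.
Qed.

(** With a = [size s] and q = [surv n], adding one particle costs at most a q^2 by [catp_le], which
    is below the increment (2 a + 1) q^2 of the error term. *)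
Lemma breedn_le_sum n s :
  Z n s D <= \sum_(y <- s) Z n [:: y] D + ((size s)%:R ^+ 2 * surv n ^+ 2)%:E.
Proof.
elim: s => [|x s IH].
  by rewrite big_nil breedn_nil// add0e lee_fin mulr_ge0 ?sqr_ge0.
rewrite breedn_cons//; apply: (le_trans (catp_le (breedn_setT mL L1 n [:: x])
  (breedn_setT mL L1 n s) mD)).
rewrite big_cons -!addeA leeD2l// survE.
apply: (le_trans (leeD IH (lee_wpmul2l _ (breedn_alive_le n s)))).
  by rewrite lee_fin surv_ge0.
rewrite -addeA leeD2l// -EFinM -EFinD lee_fin -[size (x :: s)]/(size s).+1.
rewrite -natr1; have := surv_ge0 n; have : (0 <= (size s)%:R :> R)%R by [].
set a := (size s)%:R; set q := surv n => a0 q0.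
rewrite -subr_ge0.
rewrite (_ : _ - _ = (a + 1) * q ^+ 2)%R; first by rewrite mulr_ge0 ?sqr_ge0 ?addr_ge0.
by lra.
Qed.

(** Here [catp_ge] makes an added particle cost 2 a q^2, still below the increment (2 a + 1) q^2. *)
Lemma breedn_ge_sum n s :
  \sum_(y <- s) Z n [:: y] D <= Z n s D + ((size s)%:R ^+ 2 * surv n ^+ 2)%:E.
Proof.
elim: s => [|x s IH].
  by rewrite big_nil breedn_nil// add0e lee_fin mulr_ge0 ?sqr_ge0.
rewrite big_cons; apply: (le_trans (leeD2l _ IH)).
rewrite addeA.
apply: (@le_trans _ _ (Z n (x :: s) D + 2%:E * (surv n * ((size s)%:R * surv n))%:E +
    ((size s)%:R ^+ 2 * surv n ^+ 2)%:E)).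
  rewrite leeD2r// (breedn_cons mL n x s mD).
  apply: (le_trans (catp_ge (breedn_setT mL L1 n [:: x])
    (breedn_setT mL L1 n s) mD D0)).
  rewrite leeD2l// lee_wpmul2l//.
  by rewrite survE EFinM lee_wpmul2l ?lee_fin ?surv_ge0// breedn_alive_le.
rewrite -addeA leeD2l// -EFinM -EFinD lee_fin -[size (x :: s)]/(size s).+1.
rewrite -natr1; have := surv_ge0 n; have : (0 <= (size s)%:R :> R)%R by [].
set a := (size s)%:R; set q := surv n => a0 q0.
rewrite -subr_ge0.
rewrite (_ : _ - _ = q ^+ 2)%R; first by rewrite sqr_ge0.
by lra.
Qed.

End one_set.

End population.

Section first_step.
Context {d : measure_display} {X : measurableType d} {R : realType}.
Variables (p : probability nat R) (P : X -> giry X R).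
Hypothesis mP : measurable_fun setT P.
Hypothesis P1 : forall x, P x setT = 1%E.
Hypothesis C1 : condition_C1 p.
Local Open Scope ereal_scope.
Notation L := (litter p P).
Notation mL := (measurable_litter p mP).
Notation Z := (breedn mL).
Notation surv := (surv p mP).
Let L1 x : L x setT = 1 := litter_setT p P1 x.

Lemma offspring_mean_fin : offspring_mean p \is a fin_num.
Proof.
have [/andP[m0 m1] _] := C1; rewrite ge0_fin_numE ?(ltW m0)//.
by apply: lt_trans m1 _; exact: ltry.
Qed.

Lemma offspring_moment_fin k : offspring_moment p k \is a fin_num.
Proof.
have [_ mk] := C1; rewrite ge0_fin_numE//.
by apply: nneseries_ge0 => j _ _; rewrite mule_ge0 ?lee_fin.
Qed.

Definition mean : R := fine (offspring_mean p).
Definition moment2 : R := fine (offspring_moment p 2).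

Lemma mean_gt0 : (0 < mean)%R.
Proof.
by rewrite -lte_fin /mean fineK ?offspring_mean_fin//; case: C1 => /andP[].
Qed.

Lemma mean_lt1 : (mean < 1)%R.
Proof.
by rewrite -lte_fin /mean fineK ?offspring_mean_fin//; case: C1 => /andP[].
Qed.

Lemma moment2_ge0 : (0 <= moment2)%R.
Proof.
apply: fine_ge0; apply: nneseries_ge0 => j _ _.
by rewrite mule_ge0 ?lee_fin.
Qed.

Lemma breednS_litter n x (D : set (mseq X)) : measurable D ->
  Z n.+1 [:: x] D = giry_int (L x) (fun s => Z n s D).
Proof.
move=> mD; have mF : measurable_fun setT (EFin \o \1_D : mseq X -> \bar R).
  by apply/measurable_EFinP; exact: measurable_indic.
have F0 t : 0 <= (EFin \o \1_D : mseq X -> \bar R) t by rewrite lee_fin.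
rewrite -(giry_int_indic _ mD) (giry_int_breednS mL n [:: x] mF F0).
rewrite giry_int_breed1; last 2 first.
- exact: measurable_giry_int_breedn.
- by move=> s; exact: giry_int_ge0.
by apply: eq_integral => s _; rewrite giry_int_indic.
Qed.

Lemma measurable_breedn_ev n (D : set (mseq X)) : measurable D ->
  measurable_fun setT (fun s : mseq X => Z n s D).
Proof. by move=> mD; apply: measurable_giry_ev_comp => //; exact: measurable_breedn. Qed.

Lemma measurable_breedn1_ev n (D : set (mseq X)) : measurable D ->
  measurable_fun setT (fun x => Z n [:: x] D).
Proof.
move=> mD; apply: (@measurableT_comp _ _ _ _ _ _ (fun s : mseq X => Z n s D)).
  exact: measurable_breedn_ev.
apply: measurable_fun_mseq => // -[|C [|C' Cs]] mCs.
- by rewrite (_ : _ `&` _ = set0)//; apply/seteqP; split=> // x [].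
- rewrite (_ : _ `&` _ = C); first by apply: mCs; rewrite mem_head.
  by apply/seteqP; split=> x /=; [case=> _ []|].
- by rewrite (_ : _ `&` _ = set0)//; apply/seteqP; split=> // x [_ []].
Qed.

Lemma giry_int_breedn1_fin n x (D : set (mseq X)) : measurable D ->
  giry_int (P x) (fun y => Z n [:: y] D) \is a fin_num.
Proof.
move=> mD; rewrite ge0_fin_numE; last exact: giry_int_ge0.
apply: (@le_lt_trans _ _ 1); last exact: ltry.
rewrite -[leRHS](giry_int_cst 1 (P1 x)); apply: le_giry_int => //.
- exact: measurable_breedn1_ev.
- by move=> y; exact: breedn_le1.
Qed.

Lemma measurable_size2 (c : R) :
  measurable_fun setT (fun s : mseq X => ((size s)%:R ^+ 2 * c)%:E).
Proof. exact: (measurable_fun_size (fun k => (k%:R ^+ 2 * c)%:E)). Qed.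

Lemma giry_int_litter_size2 x (c : R) : (0 <= c)%R ->
  giry_int (L x) (fun s : mseq X => ((size s)%:R ^+ 2 * c)%:E) =
  (moment2 * c)%:E.
Proof.
move=> c0; rewrite (giry_int_litter_size _ _ _ (g := fun k => (k%:R ^+ 2 * c)%:E))//.
  rewrite EFinM /moment2 fineK ?offspring_moment_fin// muleC.
  rewrite -nneseriesZl//; last by move=> k _; rewrite mule_ge0 ?lee_fin.
  by apply: eq_eseriesr => k _; rewrite natrX EFinM -muleA muleCA.
by move=> k; rewrite lee_fin mulr_ge0 ?sqr_ge0.
Qed.

Lemma sum_breedn_ge0 n (D : set (mseq X)) (s : seq X) :
  0 <= \sum_(y <- s) Z n [:: y] D.
Proof. exact: sume_ge0. Qed.

Section one_set.
Variable D : set (mseq X).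
Hypotheses (mD : measurable D) (D0 : ~ D [::]).

(** v_n(x) of the overview. *)
Definition hit n x : R := fine (Z n [:: x] D).

Lemma hitE n x : Z n [:: x] D = (hit n x)%:E.
Proof. by rewrite /hit fineK//; exact: breedn_fin. Qed.

Lemma hit_ge0 n x : (0 <= hit n x)%R.
Proof. exact: fine_ge0. Qed.

Lemma hit_le_surv n x : (hit n x <= surv n)%R.
Proof. by rewrite -lee_fin -hitE; exact: breedn_le_surv. Qed.

Lemma measurable_hit n : measurable_fun setT (hit n).
Proof. by apply: measurableT_comp => //; exact: measurable_breedn1_ev. Qed.

(** Given the litter [s] of the ancestor, [breedn_le_sum] compares with a sum over [s]. In
    expectation the sum becomes m P v_n, and the squared litter size becomes the second moment. *)
Lemma hitS_le n x :
  (hit n.+1 x <= mean * fine (\int[P x]_y (hit n y)%:E) + moment2 * surv n ^+ 2)%R.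
Proof.
rewrite -lee_fin -hitE breednS_litter// EFinD EFinM.
rewrite -(giry_int_litter_size2 x)// ?sqr_ge0//.
rewrite [in leRHS](_ : \int[P x]_y _ = giry_int (P x) (fun y => Z n [:: y] D)); last first.
  by apply: eq_integral => y _; rewrite hitE.
rewrite !fineK ?offspring_mean_fin ?giry_int_breedn1_fin//.
rewrite -giry_int_litter_sum//; last 2 first.
- exact: measurable_breedn1_ev.
- exact: giry_int_breedn1_fin.
rewrite /giry_int -ge0_integralD//; last 4 first.
- by move=> s _; exact: sum_breedn_ge0.
- by apply: measurable_sum_list; exact: measurable_breedn1_ev.
- by move=> s _; rewrite lee_fin mulr_ge0 ?sqr_ge0.
- exact: measurable_size2.
apply: le_giry_int => //.
- exact: measurable_breedn_ev.
- apply: emeasurable_funD; last exact: measurable_size2.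
  by apply: measurable_sum_list; exact: measurable_breedn1_ev.
- by move=> s; exact: breedn_le_sum.
Qed.

Lemma hitS_ge n x :
  (mean * fine (\int[P x]_y (hit n y)%:E) <= hit n.+1 x + moment2 * surv n ^+ 2)%R.
Proof.
rewrite -lee_fin EFinD -hitE breednS_litter// EFinM.
rewrite -(giry_int_litter_size2 x)// ?sqr_ge0//.
rewrite [in leLHS](_ : \int[P x]_y _ = giry_int (P x) (fun y => Z n [:: y] D)); last first.
  by apply: eq_integral => y _; rewrite hitE.
rewrite !fineK ?offspring_mean_fin ?giry_int_breedn1_fin//.
rewrite -giry_int_litter_sum//; last 2 first.
- exact: measurable_breedn1_ev.
- exact: giry_int_breedn1_fin.
rewrite /giry_int -ge0_integralD//; last 3 first.
- exact: measurable_breedn_ev.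
- by move=> s _; rewrite lee_fin mulr_ge0 ?sqr_ge0.
- exact: measurable_size2.
apply: le_giry_int => //.
- by apply: measurable_sum_list; exact: measurable_breedn1_ev.
- apply: emeasurable_funD; last exact: measurable_size2.
  exact: measurable_breedn_ev.
- by move=> s; exact: sum_breedn_ge0.
- by move=> s; exact: breedn_ge_sum.
Qed.

End one_set.

Lemma surv_hit n x : surv n = hit alive n x.
Proof. by apply: EFin_inj; rewrite -hitE ?survE//; exact: measurable_alive. Qed.

Lemma survS_le n : (surv n.+1 <= mean * surv n)%R.
Proof.
have ma := @measurable_alive _ X.
rewrite -lee_fin -(survE p mP P1 n.+1 point) breednS_litter// EFinM.
rewrite /mean fineK ?offspring_mean_fin//.
have -> : offspring_mean p * (surv n)%:E =
    giry_int (L point) (fun s : mseq X => ((size s)%:R * surv n)%:E).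
  rewrite (giry_int_litter_size _ _ _ (g := fun k => (k%:R * surv n)%:E))//; last first.
    by move=> k; rewrite lee_fin mulr_ge0 ?surv_ge0.
  rewrite muleC -nneseriesZl//; last by move=> k _; rewrite mule_ge0 ?lee_fin.
  by apply: eq_eseriesr => k _; rewrite EFinM -muleA muleCA.
apply: le_giry_int => //.
- exact: measurable_breedn_ev.
- exact: (measurable_fun_size (fun k => (k%:R * surv n)%:E)).
- by move=> s; exact: breedn_alive_le.
Qed.

(** The lower recursion for [alive], whose probability is constant in the position: averaging under
    [P] leaves it unchanged. *)
Lemma survS_ge n : (mean * surv n <= surv n.+1 + moment2 * surv n ^+ 2)%R.
Proof.
have ma := @measurable_alive _ X.
have nn : ~ (alive : set (seq X)) [::] by [].
have := hitS_ge ma nn n point; rewrite -surv_hit.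
rewrite (eq_integral (cst (surv n)%:E)); last by move=> y _; rewrite -surv_hit.
by rewrite -[X in fine X]/(giry_int (P point) (fun=> (surv n)%:E)) giry_int_cst.
Qed.

(** A positive mean provides a litter size k > 0 of positive probability; with such a litter, the
    line of the first child alone survives with probability [surv n]. *)
Lemma surv_gt0 n : (0 < surv n)%R.
Proof.
have ma := @measurable_alive _ X.
elim: n => [|n IH].
  by rewrite -lte_fin -(survE p mP P1 0 point) /= diracE mem_set//= lte_fin.
rewrite -lte_fin -(survE p mP P1 n.+1 point) breednS_litter//.
have [k k0 pk] : exists2 k, (0 < k)%N & 0 < p [set k].
  apply: contrapT => /forall2NP h; have := mean_gt0.
  rewrite /mean /offspring_mean eseries0 ?ltxx// => -[|k] _ _; first by rewrite mul0e.
  have [//|/negP] := h k.+1; rewrite -leNgt => pk0.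
  by have -> : p [set k.+1] = 0; [apply/eqP; rewrite eq_le pk0 measure_ge0|rewrite mule0].
apply: (@lt_le_trans _ _ (p [set k] * (surv n)%:E)).
  by rewrite mule_gt0 ?lte_fin.
have -> : p [set k] * (surv n)%:E = giry_int (L point)
    (fun s : mseq X => (surv n * (size s == k)%:R)%:E).
  rewrite (giry_int_litter_size _ _ _ (g := fun j => (surv n * (j == k)%:R)%:E))//; last first.
    by move=> j; rewrite lee_fin mulr_ge0 ?surv_ge0.
  rewrite (@nneseriesD1 _ _ k)//; last first.
    by move=> j _; rewrite mule_ge0 ?lee_fin ?mulr_ge0 ?surv_ge0.
  rewrite eqxx mulr1 muleC eseries0 ?adde0// => j _ /negbTE ->.
  by rewrite mulr0 mul0e.
apply: le_giry_int => //.
- exact: (measurable_fun_size (fun j => (surv n * (j == k)%:R)%:E)).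
- exact: measurable_breedn_ev.
- by move=> s; rewrite lee_fin mulr_ge0 ?surv_ge0.
- move=> s; have [sk|_] := eqVneq; last by rewrite mulr0.
  rewrite mulr1; case: s sk => [sk|x s _]; first by rewrite -sk in k0.
  rewrite -(survE p mP P1 n x) (breedn_cons mL n x s ma).
  apply: catp_alive_ge; exact: breedn_setT.
Qed.

End first_step.

(** * Setwise limits of measures *)

Section uniform_limit.
Context {R : realType}.

(** An interchange of limits in quantitative form: [u] need only come eventually within b n + e of
    each approximant [a n], and one n with b n small then suffices. *)
Lemma cvg_sandwich (a b u : nat -> R) (l : R) :
  b @ \oo --> (0 : R) -> (forall n, `|l - a n| <= b n) ->
  (forall n e, 0 < e -> \forall N \near \oo, `|u N - a n| <= b n + e) ->
  u @ \oo --> l.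
Proof.
move=> b0 la ua; apply/cvgrPdist_le => e e0.
have e4 : 0 < e / 4 by rewrite divr_gt0.
have [n _ /(_ n (leqnn n)) /= bn] : \forall n \near \oo, `|0 - b n| <= e / 4.
  by move/cvgrPdist_le : b0; apply.
near=> N.
have : `|u N - a n| <= b n + e / 4 by near: N; exact: ua.
have := la n; move: bn; rewrite sub0r normrN ler_norml => /andP[_ bn].
by rewrite !ler_norml => /andP[? ?] /andP[? ?]; apply/andP; split; lra.
Unshelve. all: by end_near. Qed.

(** The hypothesis makes [a] Cauchy; letting k tend to infinity in it leaves b n alone as the
    distance to the limit. *)
Lemma cvg_dist_sum (a b : nat -> R) : b @ \oo --> (0 : R) ->
  (forall n k, `|a n - a k| <= b n + b k) ->
  exists2 l : R, a @ \oo --> l & forall n, `|l - a n| <= b n.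
Proof.
move=> b0 ab; have ca : cvgn a.
  apply/cauchy_cvgP/cauchy_ballP => e e0; near_simpl.
  have e4 : 0 < e / 4 by rewrite divr_gt0.
  near=> m n => /=; rewrite /ball /=; apply: (le_lt_trans (ab _ _)).
  have : `|0 - b m| <= e / 4 by near: m; move/cvgrPdist_le : b0; apply.
  have : `|0 - b n| <= e / 4 by near: n; move/cvgrPdist_le : b0; apply.
  by rewrite !sub0r !normrN !ler_norml => /andP[_ ?] /andP[_ ?]; lra.
exists (limn a) => // n.
apply/ler_addgt0Pr => e e0.
have [k _ /(_ k (leqnn k))/= kl] :
    \forall k \near \oo, `|limn a - a k| <= e / 2 /\ `|0 - b k| <= e / 2.
  near=> k; split; near: k.
  - by move/cvgrPdist_le : ca; apply; rewrite divr_gt0.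
  - by move/cvgrPdist_le : b0; apply; rewrite divr_gt0.
have := ab n k; move: kl => [+]; rewrite sub0r normrN.
rewrite !ler_norml => /andP[? ?] /andP[? ?] /andP[? ?].
by apply/andP; split; lra.
Unshelve. all: by end_near. Qed.

Section measures.
Context {d : measure_display} {T : measurableType d}.
Variables (mu : nat -> {measure set T -> \bar R}) (b : nat -> R).
Hypothesis mufin : forall n, (mu n setT < +oo)%E.
Hypothesis b0 : b @ \oo --> (0 : R).
Hypothesis mub : forall n k A, measurable A ->
  `|fine (mu n A) - fine (mu k A)| <= b n + b k.

(* The upper limit, rather than the limit, is nonnegative also at the
   nonmeasurable sets, where nothing converges. *)
Definition ulim (A : set T) : \bar R := limn_esup (fun n => mu n A).

Let fin n A : measurable A -> mu n A \is a fin_num.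
Proof.
move=> mA; rewrite ge0_fin_numE//; apply: le_lt_trans (mufin n).
by apply: le_measure; rewrite ?inE.
Qed.

Lemma ulimP A : measurable A ->
  exists l : R, [/\ ulim A = l%:E, fine (mu n A) @[n --> \oo] --> l &
                    forall n, `|l - fine (mu n A)| <= b n].
Proof.
move=> mA; have [|l al lb] := cvg_dist_sum (a := fun n => fine (mu n A)) b0.
  by move=> n k; exact: mub.
exists l; split => //; rewrite /ulim.
have ml : mu n A @[n --> \oo] --> l%:E.
  rewrite (_ : (fun n => mu n A) = (fun n => (fine (mu n A))%:E)).
    by apply: cvg_EFin => //; exact: nearW.
  by apply/funext => n; rewrite fineK// fin.
by rewrite is_cvg_limn_esupE; [exact: cvg_lim|apply/cvg_ex; exists l%:E].
Qed.

Let ulim0 : ulim set0 = 0%E.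
Proof.
rewrite /ulim (_ : (fun n => _) = cst 0%E); last first.
  by apply/funext => n; rewrite measure0.
by rewrite is_cvg_limn_esupE; [exact: lim_cst|exact: is_cvg_cst].
Qed.

Let ulim_ge0 A : (0 <= ulim A)%E.
Proof.
rewrite /ulim limn_esup_lim; apply: lime_ge; first exact: is_cvg_esups.
apply: nearW => n; apply: (@le_trans _ _ (mu n A)) => //.
by apply: ereal_sup_ubound; exists n => /=.
Qed.

(** Finite additivity passes to the limit at once. The countable case exchanges the limits in n and
    N, which is licit because the error b n is the same for all measurable sets. *)
Let ulim_sigma_additive : semi_sigma_additive ulim.
Proof.
move=> F mF tF mU.
pose U := \bigcup_n F n; pose V N := \big[setU/set0]_(i < N) F i.
have mV N : measurable (V N) by exact: bigsetU_measurable.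
pose s N := \sum_(0 <= i < N) fine (ulim (F i)).
have muV n N : fine (mu n (V N)) = \sum_(0 <= i < N) fine (mu n (F i)).
  rewrite /V measure_semi_additive//; last exact: mV.
  by rewrite big_mkord sum_fine// => i _; exact: fin.
have sV N : ulim (V N) = (s N)%:E.
  have [l [-> lV _]] := ulimP (mV N); congr (_%:E).
  apply: (cvg_unique _ lV) => //.
  rewrite (_ : (fun n => _) =
    (fun n => \sum_(0 <= i < N) fine (mu n (F i)))); last first.
    by apply/funext => n; rewrite muV.
  rewrite /s; apply: cvg_big => [|i _]; first exact: add_continuous.
  by have [li [-> ]] := ulimP (mF i).
have [l [lU _ lb]] := ulimP mU.
rewrite lU (_ : (fun N => _) = (fun N => (s N)%:E)); last first.
  apply/funext => N; rewrite /s -sumEFin; apply: eq_bigr => i _.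
  by have [li [-> _ _]] := ulimP (mF i).
apply: cvg_EFin; first exact: nearW.
(* For fixed n, [s N] is within b n of [mu n (V N)], which tends to [mu n U] by sigma-additivity of
   [mu n]. *)
apply: (cvg_sandwich (a := fun n => fine (mu n U)) b0) => // n e e0.
have Ve : fine (mu n (V N)) @[N --> \oo] --> fine (mu n U).
  rewrite (_ : (fun N => _) =
    fine \o (fun N => (\sum_(0 <= i < N) mu n (F i))%E)); last first.
    apply/funext => N /=; rewrite muV sum_fine// => i _; exact: fin.
  apply: fine_cvg; rewrite fineK ?fin//.
  exact: measure_semi_sigma_additive.
near=> N.
have [l' [+ _ /(_ n)]] := ulimP (mV N).
rewrite sV => -[<-] sb.
have : `|fine (mu n U) - fine (mu n (V N))| <= e.
  by near: N; move/cvgrPdist_le : Ve; apply.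
suff : `|s N - fine (mu n (V N))| <= b n ->
  `|fine (mu n U) - fine (mu n (V N))| <= e ->
  `|s N - fine (mu n U)| <= b n + e by move=> /(_ sb).
rewrite !ler_norml => /andP[? ?] /andP[? ?].
by apply/andP; split; lra.
Unshelve. all: by end_near. Qed.

HB.instance Definition _ := isMeasure.Build _ _ _ ulim
  ulim0 ulim_ge0 ulim_sigma_additive.

Definition ulim_measure : {measure set T -> \bar R} := ulim.

End measures.
End uniform_limit.

(** * Integrals of bounded functions under setwise convergence *)

Section staircase.
Context {R : realType}.
Implicit Types (y e : R) (n : nat).

(** For e > 0 and y >= 0, this rounds y down to a multiple of e, with cap e n. Written with
    indicators of level sets, it has an integral that is a combination of measures of these sets. *)
Definition stairs e n y : R := e * \sum_(i < n) (e * i.+1%:R <= y)%R%:R.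

Lemma stairs_bounds e n y : 0 <= e -> 0 <= y ->
  [/\ stairs e n y <= y, y <= e * n%:R -> y - e <= stairs e n y &
      e * n%:R <= y -> stairs e n y = e * n%:R].
Proof.
move=> e0 y0; rewrite /stairs; elim: n => [|n [IH1 IH2 IH3]].
  by rewrite big_ord0 !mulr0; split => //; lra.
rewrite big_ord_recr/=; have [yn|yn] := leP (e * n.+1%:R) y.
  have yn' : e * n%:R <= y by apply: le_trans yn; rewrite ler_wpM2l// ler_nat.
  have -> : e * (\sum_(i < n) (e * i.+1%:R <= y)%R%:R + true%:R) = e * n.+1%:R.
    by rewrite mulrDr IH3// -natr1 mulrDr.
  by split => //; lra.
rewrite addr0; split => //.
move=> _; have [|/ltW yn'] := leP y (e * n%:R); first exact: IH2.
by rewrite IH3//; move: yn; rewrite -natr1 mulrDr; lra.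
Qed.

End staircase.

Section setwise_convergence.
Context {R : realType} {d : measure_display} {T : measurableType d}.

(** The shift by [M] makes f nonnegative and at most 2 M, a range that n steps of height e cover;
    rounding then costs at most e per unit of mass. *)
Lemma Rintegral_staircase (mu : {measure set T -> \bar R}) (f : T -> R) (M e : R) n :
  (mu setT < +oo)%E -> measurable_fun setT f -> (forall x, `|f x| <= M) ->
  0 <= e -> 2 * M <= e * n%:R ->
  `|\int[mu]_x f x - (e * \sum_(i < n) fine (mu [set x | e * i.+1%:R <= f x + M])
      - M * fine (mu setT))| <= e * fine (mu setT).
Proof.
move=> muT mf fM e0 Mn.
have integ (g : T -> R) C : measurable_fun setT g -> (forall x, `|g x| <= C) ->
    mu.-integrable setT (EFin \o g).
  move=> mg gC; apply: measurable_bounded_integrable => //.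
  exists C; split; first exact: num_real.
  by move=> c Cc x _; apply: le_trans (gC x) (ltW Cc).
pose A i := [set x | e * i.+1%:R <= f x + M].
have mA i : measurable (A i).
  rewrite -[A i]setTI /A.
  rewrite (_ : [set x | _] = (fun x => f x + M) @^-1` `[e * i.+1%:R, +oo[).
    by apply: measurable_funD.
  by apply/seteqP; split => x /=; rewrite in_itv/= andbT.
pose g x := stairs e n (f x + M).
have gE x : g x = e * \sum_(i < n) \1_(A i) x.
  congr (_ * _); apply: eq_bigr => i _; rewrite indicE; congr (_%:R).
  by congr nat_of_bool; apply/idP/idP; rewrite inE.
have mg : measurable_fun setT g.
  rewrite (_ : g = fun x => e * \sum_(i < n) \1_(A i) x); last exact/funext.
  apply: measurable_funM => //; apply: measurable_sum => i.
  exact: measurable_indic.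
have fM0 x : 0 <= f x + M by have := fM x; rewrite ler_norml => /andP[? ?]; lra.
have fMn x : f x + M <= e * n%:R.
  by have := fM x; rewrite ler_norml => /andP[? ?]; lra.
have gf x : `|f x - (g x - M)| <= e.
  have [g1 g2 _] := stairs_bounds n e0 (fM0 x).
  by have := g2 (fMn x); rewrite -/(g x) in g1 *; rewrite ler_norml; lra.
have ig : \int[mu]_x (g x - M) =
    e * \sum_(i < n) fine (mu (A i)) - M * fine (mu setT).
  rewrite RintegralB//; last 2 first.
  - apply: (integ _ (2 * M + e)) => // x.
    have := gf x; have := fM x; rewrite !ler_norml => /andP[? ?] /andP[? ?].
    by lra.
  - exact: (integ _ `|M|).
  rewrite Rintegral_cst//; congr (_ - _).
  have ms : measurable_fun setT (fun x => \sum_(i < n) \1_(A i) x : R).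
    by apply: measurable_sum => i; exact: measurable_indic.
  transitivity (\int[mu]_x (e * \sum_(i < n) \1_(A i) x)).
    by apply: eq_Rintegral => x _; exact: gE.
  rewrite RintegralZl//; last first.
    apply: (integ _ n%:R) => // x; rewrite ger0_norm ?sumr_ge0//.
    rewrite -[leRHS](mulr1 n%:R) mulr_natl -[X in _ *+ X](card_ord n) -sumr_const.
    by apply: ler_sum => i _; rewrite indicE; case: (_ \in _).
  congr (_ * _); rewrite /Rintegral sum_fine => [|i _]; last first.
    rewrite ge0_fin_numE//; apply: le_lt_trans muT.
    by apply: le_measure; rewrite ?inE.
  congr fine; under eq_integral do rewrite -sumEFin.
  rewrite ge0_integral_sum//.
    by apply: eq_bigr => i _; rewrite integral_indic// setIT.
  by move=> i; apply/measurable_EFinP; exact: measurable_indic.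
have igM : mu.-integrable setT (EFin \o (fun x => g x - M)).
  apply: (integ _ (M + e)); first exact: measurable_funB.
  move=> x; have := gf x; have := fM x; rewrite !ler_norml.
  by move=> /andP[? ?] /andP[? ?]; lra.
rewrite -ig -RintegralB//; last exact: (integ _ M).
have mfg : measurable_fun setT (fun x => f x - (g x - M)).
  by apply: measurable_funB => //; exact: measurable_funB.
apply: (le_trans (le_normr_Rintegral _ _)) => //; first exact: (integ _ e).
rewrite -Rintegral_cst//; apply: le_Rintegral => //.
- apply: (integ _ e); first exact: measurableT_comp.
  by move=> x; rewrite normr_id.
- by apply: (integ _ e) => // x; rewrite ger0_norm.
Qed.

(** The level sets of the staircase are the same for all measures, so setwise convergence applies to
    each of the finitely many; the rounding error is uniform because the masses are eventually
    bounded. *)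
Lemma cvg_Rintegral_setwise (mu : nat -> {measure set T -> \bar R})
    (nu : {measure set T -> \bar R}) (f : T -> R) :
  (forall n, mu n setT < +oo)%E -> (nu setT < +oo)%E ->
  (forall A, measurable A -> fine (mu n A) @[n --> \oo] --> fine (nu A)) ->
  measurable_fun setT f -> [bounded f x | x in setT] ->
  \int[mu n]_x f x @[n --> \oo] --> \int[nu]_x f x.
Proof.
move=> muT nuT munu mf [M0' [_ /(_ (M0' + 1))/=]]; rewrite ltrDl ltr01.
move=> /(_ isT) fM'; set M := M0' + 1 in fM'.
have {fM'} fM x : `|f x| <= M by exact: fM'.
have M0 : 0 <= M := le_trans (normr_ge0 _) (fM point).
(* The height for which [N.+1] steps exactly cover [0, 2 M]. *)
pose e N : R := 2 * M / N.+1%:R.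
have e0 N : 0 <= e N by rewrite divr_ge0// mulr_ge0.
have eN N : 2 * M <= e N * N.+1%:R by rewrite divfK.
(* Eventual bound of the masses, [mu n setT] being within 1 of [nu setT] for large n. *)
pose C := fine (nu setT) + 1.
have C0 : 0 <= C by rewrite addr_ge0// fine_ge0.
pose step (m : {measure set T -> \bar R}) N := e N * \sum_(i < N.+1)
  fine (m [set x | e N * i.+1%:R <= f x + M]) - M * fine (m setT).
have mA N i : measurable [set x | e N * i.+1%:R <= f x + M].
  rewrite -[X in measurable X]setTI.
  rewrite (_ : [set x | _] = (fun x => f x + M) @^-1` `[e N * i.+1%:R, +oo[).
    by apply: measurable_funD.
  by apply/seteqP; split => x /=; rewrite in_itv/= andbT.
apply: (@cvg_sandwich _ (step nu) (fun N => e N * C)).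
- rewrite -[X in _ --> X](mul0r C); apply: cvgMl.
  rewrite -[X in _ --> X](mulr0 (2 * M)); apply: cvgMr.
  exact: cvg_harmonic.
- move=> N; apply: (le_trans (Rintegral_staircase _ _ _ _ _)) => //.
  by rewrite ler_wpM2l// lerDl.
move=> N eps eps0.
have cstep : step (mu n) N @[n --> \oo] --> step nu N.
  apply: cvgB; apply: cvgMr; last exact: munu.
  by apply: cvg_big => [|i _]; [exact: add_continuous|exact: munu].
near=> n.
have H1 : `|\int[mu n]_x f x - step (mu n) N| <= e N * C.
  apply: (le_trans (Rintegral_staircase _ _ _ _ _)) => //.
  rewrite ler_wpM2l//; near: n.
  have : \forall n \near \oo, `|fine (nu setT) - fine (mu n setT)| <= 1.
    by move/cvgrPdist_le : (munu _ measurableT); apply.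
  apply: filterS => n; rewrite /C ler_norml => /andP[? ?]; lra.
have H2 : `|step nu N - step (mu n) N| <= eps.
  by near: n; move/cvgrPdist_le : cstep; apply.
rewrite -(subrK (step (mu n) N) (\int[mu n]_x f x)) -addrA.
by apply: (le_trans (ler_normD _ _)); rewrite lerD// distrC.
Unshelve. all: by end_near. Qed.

End setwise_convergence.

(** * The limit measure *)

Section giry_of_kernel.
Context {d d' : measure_display} {X : measurableType d} {Y : measurableType d'}.
Context {R : realType}.
Variable k : R.-spker X ~> Y.

Let kx (x : X) : set Y -> \bar R := k x.

HB.instance Definition _ x := isMeasure.Build _ _ _ (kx x) (measure0 (k x))
  (measure_ge0 (k x)) (@measure_semi_sigma_additive _ _ _ (k x)).

HB.instance Definition _ x := Measure_isSubProbability.Build _ _ _ (kx x)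
  (sprob_kernel_le1 k x).

(** The same kernel as a map into the space of measures, so that [giry_bind] and [giry_int] apply to
    it. *)
Definition kgiry (x : X) : giry Y R := kx x.

Lemma measurable_kgiry : measurable_fun setT kgiry.
Proof.
by apply: measurable_giry_codensity => // B mB; exact: measurable_kernel.
Qed.

End giry_of_kernel.

Section nstep_integral.
Context {R : realType} (P : R.-pker measurableTypeR R ~> measurableTypeR R).
Local Open Scope ereal_scope.

Lemma integral_nstep0 x (f : measurableTypeR R -> \bar R) :
  measurable_fun setT f -> \int[nstep P 0 x]_y f y = f x.
Proof.
move=> mf; rewrite integral_dirac// diracT mul1e//.
Qed.

Lemma integral_nstepS n x (f : measurableTypeR R -> \bar R) :
  measurable_fun setT f -> (forall y, 0 <= f y) ->
  \int[nstep P n.+1 x]_y f y = \int[P x]_z \int[nstep P n z]_y f y.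
Proof.
move=> mf f0.
transitivity (giry_int (giry_bind (kgiry P x) (measurable_kgiry (nstep P n))) f).
  apply: eq_measure_integral => A mA _.
  exact/esym/(giry_bindE (kgiry P x) (measurable_kgiry (nstep P n)) mA).
by rewrite giry_int_bind.
Qed.

End nstep_integral.

(** * The functions w_n and their almost invariance under [P] *)

Section normalized_hits.
Context {R : realType}.
Variables (p : probability nat R)
  (P : R.-pker measurableTypeR R ~> measurableTypeR R).
Hypothesis C1 : condition_C1 p.
Local Open Scope ereal_scope.
Notation X := (measurableTypeR R).
Let PG : X -> giry X R := kgiry P.
Let mP : measurable_fun setT PG := measurable_kgiry P.
Let P1 x : PG x setT = 1. Proof. exact: prob_kernel. Qed.
Notation Z := (breedn (measurable_litter p mP)).
Notation surv := (surv p mP).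
Notation m := (mean p).
Let m0 : (0 < m)%R := mean_gt0 C1.
Let m1 : (m < 1)%R := mean_lt1 C1.

Lemma surv_le_mean n : (surv n <= m ^+ n)%R.
Proof.
elim: n => [|n IH]; first exact: surv_le1.
by rewrite exprS (le_trans (survS_le _ _ _ _))// ler_wpM2l// ltW.
Qed.

(* [defect * m ^+ n] bounds the error made by replacing [v_(n+1) / m ^+ n.+1] by
   [P v_n / m ^+ n]. *)
Definition defect : R := (moment2 p / m)%R.

Lemma defect_ge0 : (0 <= defect)%R.
Proof. by rewrite divr_ge0 ?moment2_ge0// ltW. Qed.

(** By [surv_le_mean] the squared survival probability is at most m^(2n), and the normalization
    consumes only one of the two powers, up to the factor 1 / m kept in [defect]. *)
Lemma surv2_le n : (moment2 p * surv n ^+ 2 / m ^+ n.+1 <= defect * m ^+ n)%R.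
Proof.
have -> : (defect * m ^+ n = moment2 p * (m ^+ n * m ^+ n) / m ^+ n.+1)%R.
  rewrite /defect exprS invfM -!mulrA; congr (_ * _)%R.
  by rewrite mulrC; congr (_ * _)%R; rewrite mulrCA divff ?mulr1// expf_neq0// gt_eqF.
rewrite ler_wpM2r ?invr_ge0 ?exprn_ge0 ?(ltW m0)//.
by rewrite ler_wpM2l ?moment2_ge0// expr2 ler_pM ?surv_ge0 ?surv_le_mean.
Qed.

Section one_set.
Variable D : set (mseq X).
Hypotheses (mD : measurable D) (D0 : ~ D [::]).

(** w_n of the overview. *)
Definition nhit n x : R := (hit p mP D n x / m ^+ n)%R.

Lemma nhit_ge0 n x : (0 <= nhit n x)%R.
Proof. by rewrite divr_ge0 ?hit_ge0// exprn_ge0// ltW. Qed.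

Lemma nhit_le1 n x : (nhit n x <= 1)%R.
Proof.
rewrite ler_pdivrMr ?exprn_gt0// mul1r.
by apply: le_trans (surv_le_mean n); exact: hit_le_surv.
Qed.

Lemma measurable_nhit n : measurable_fun setT (nhit n).
Proof. by apply: measurable_funM => //; exact: measurable_hit. Qed.

Lemma measurable_nhit_EFin n : measurable_fun setT (fun x => (nhit n x)%:E).
Proof. by apply/measurable_EFinP; exact: measurable_nhit. Qed.

Lemma integral_nhit n x :
  \int[P x]_y (nhit n y)%:E = (fine (\int[P x]_y (hit p mP D n y)%:E) / m ^+ n)%:E.
Proof.
have mh : measurable_fun setT (fun y => (hit p mP D n y)%:E).
  by apply/measurable_EFinP; exact: measurable_hit.
have hf : \int[P x]_y (hit p mP D n y)%:E \is a fin_num.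
  rewrite ge0_fin_numE; last by apply: integral_ge0 => y _; rewrite lee_fin hit_ge0.
  apply: (@le_lt_trans _ _ (\int[P x]_y cst 1 y)); last first.
    by rewrite integral_cst// prob_kernel mul1e ltry.
  apply: ge0_le_integral => // y _; first by rewrite lee_fin hit_ge0.
  rewrite /cst lee_fin; apply: (@le_trans _ _ (surv n)); last exact: surv_le1.
  exact: hit_le_surv.
rewrite EFinM fineK// muleC -ge0_integralZl//.
- by apply: eq_integral => y _; rewrite -EFinM mulrC.
- by move=> y _; rewrite lee_fin hit_ge0.
- by rewrite lee_fin invr_ge0 exprn_ge0// ltW.
Qed.

Lemma nhitS_le n x :
  (nhit n.+1 x)%:E <= \int[P x]_y (nhit n y)%:E + (defect * m ^+ n)%:E.
Proof.
rewrite integral_nhit -EFinD lee_fin.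
apply: (@le_trans _ _ ((m * fine (\int[P x]_y (hit p mP D n y)%:E) +
    moment2 p * surv n ^+ 2) / m ^+ n.+1)%R).
  rewrite ler_wpM2r ?invr_ge0 ?exprn_ge0 ?(ltW m0)//.
  exact: (hitS_le mP P1 C1 mD D0 n x).
rewrite mulrDl lerD ?surv2_le//.
by rewrite exprS invfM mulrACA divff ?gt_eqF// mul1r.
Qed.

Lemma nhitS_ge n x :
  \int[P x]_y (nhit n y)%:E <= (nhit n.+1 x)%:E + (defect * m ^+ n)%:E.
Proof.
rewrite integral_nhit -EFinD lee_fin.
apply: (@le_trans _ _ ((hit p mP D n.+1 x + moment2 p * surv n ^+ 2) / m ^+ n.+1)%R).
  rewrite ler_pdivlMr ?exprn_gt0// exprS mulrCA divfK ?gt_eqF ?exprn_gt0//.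
  exact: (hitS_ge mP P1 C1 mD D0 n x).
by rewrite mulrDl lerD2l surv2_le.
Qed.

(** Error accumulated from generation n to generation n + k. Being constant in the position, it
    passes unchanged through the probability kernel [P]. *)
Let drift n k : R := (defect * \sum_(j < k) m ^+ (n + j))%R.

Let drift_ge0 n k : (0 <= drift n k)%R.
Proof.
by rewrite mulr_ge0 ?defect_ge0// sumr_ge0// => j _; rewrite exprn_ge0// ltW.
Qed.

Let driftS n k : (drift n k.+1 = drift n k + defect * m ^+ (n + k))%R.
Proof. by rewrite /drift big_ord_recr/= mulrDr. Qed.

Let integral_drift n k x (f : X -> \bar R) : measurable_fun setT f ->
  (forall y, 0 <= f y) ->
  \int[P x]_y (f y + (drift n k)%:E) = \int[P x]_y f y + (drift n k)%:E.
Proof.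
move=> mf f0; rewrite ge0_integralD//; last by move=> y _; rewrite lee_fin.
by rewrite integral_cst// prob_kernel mule1.
Qed.

Lemma measurable_integral_nstep n k :
  measurable_fun setT (fun x => \int[nstep P k x]_y (nhit n y)%:E).
Proof.
apply: measurable_fun_integral_kernel.
- by move=> U mU; exact: measurable_kernel.
- by move=> y; rewrite lee_fin nhit_ge0.
- exact: measurable_nhit_EFin.
Qed.

Lemma integral_nstep_nhit_ge0 n k x : 0 <= \int[nstep P k x]_y (nhit n y)%:E.
Proof. by apply: integral_ge0 => y _; rewrite lee_fin nhit_ge0. Qed.

(** The newest error comes from [nhitS_le] at generation n + k; the older ones sit in the induction
    hypothesis, which is integrated under [P]. *)
Lemma nhitD_le n k x :
  (nhit (n + k) x)%:E <= \int[nstep P k x]_y (nhit n y)%:E + (drift n k)%:E.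
Proof.
elim: k x => [|k IH] x.
  rewrite addn0 integral_nstep0; last exact: measurable_nhit_EFin.
  by rewrite leeDl// lee_fin.
rewrite addnS; apply: (le_trans (nhitS_le _ _)).
rewrite driftS EFinD addeA leeD2r//.
rewrite integral_nstepS; last 2 first.
- exact: measurable_nhit_EFin.
- by move=> y; rewrite lee_fin nhit_ge0.
rewrite -integral_drift; last 2 first.
- exact: measurable_integral_nstep.
- by move=> y; exact: integral_nstep_nhit_ge0.
apply: ge0_le_integral => //.
- by move=> y _; rewrite lee_fin nhit_ge0.
- exact: measurable_nhit_EFin.
- by apply: emeasurable_funD => //; exact: measurable_integral_nstep.
Qed.

Lemma nhitD_ge n k x :
  \int[nstep P k x]_y (nhit n y)%:E <= (nhit (n + k) x)%:E + (drift n k)%:E.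
Proof.
elim: k x => [|k IH] x.
  rewrite addn0 integral_nstep0; last exact: measurable_nhit_EFin.
  by rewrite leeDl// lee_fin.
rewrite addnS driftS EFinD [(drift n k)%:E + _]addeC addeA.
apply: (@le_trans _ _ (\int[P x]_y (nhit (n + k) y)%:E + (drift n k)%:E)); last first.
  by rewrite leeD2r// nhitS_ge.
rewrite integral_nstepS; last 2 first.
- exact: measurable_nhit_EFin.
- by move=> y; rewrite lee_fin nhit_ge0.
rewrite -integral_drift; last 2 first.
- exact: measurable_nhit_EFin.
- by move=> y; rewrite lee_fin nhit_ge0.
apply: ge0_le_integral => //.
- by move=> y _; exact: integral_nstep_nhit_ge0.
- exact: measurable_integral_nstep.
- by apply: emeasurable_funD => //; exact: measurable_nhit_EFin.
Qed.

(** [defect] times the whole geometric series from [m ^+ n] on: a bound of the drift that is uniform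
    in k, and the C m^n of the overview. *)
Definition tail n : R := (defect * (m ^+ n / (1 - m)))%R.

Lemma drift_le n k : (drift n k <= tail n)%R.
Proof.
rewrite ler_wpM2l ?defect_ge0//.
under eq_bigr do rewrite exprD; rewrite -mulr_sumr.
rewrite ler_wpM2l ?exprn_ge0 ?(ltW m0)//.
rewrite -[leRHS]mul1r ler_pdivlMr ?subr_gt0//.
have := subrX1 m k; have : (0 <= m ^+ k)%R by rewrite exprn_ge0// ltW.
by move: (m ^+ k)%R (\sum_(i < k) m ^+ i)%R => u v; lra.
Qed.

Lemma integral_nstep_nhit_fin n k x :
  \int[nstep P k x]_y (nhit n y)%:E \is a fin_num.
Proof.
rewrite ge0_fin_numE; last exact: integral_nstep_nhit_ge0.
by apply: (le_lt_trans (nhitD_ge n k x)); rewrite -EFinD ltry.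
Qed.

Lemma nhitD_dist n k x :
  (`|nhit (n + k) x - fine (\int[nstep P k x]_y (nhit n y)%:E)| <= tail n)%R.
Proof.
have fin := integral_nstep_nhit_fin n k x.
have := nhitD_le n k x; have := nhitD_ge n k x.
rewrite -(fineK fin) -!EFinD !lee_fin ler_norml.
by have := drift_le n k; move=> ? ? ?; apply/andP; split; lra.
Qed.

Section limit.
Variable pi : probability X R.
Hypothesis C3 : forall h : X -> R, measurable_fun setT h ->
  (forall y, (0 <= h y)%R) -> [bounded h y | y in setT] ->
  forall x : R,
  \int[nstep P n x]_y (h y)%:E @[n --> \oo] --> \int[pi]_y (h y)%:E.

Definition avg_nhit n : R := fine (\int[pi]_x (nhit n x)%:E).

Lemma integral_pi_nhit n : \int[pi]_x (nhit n x)%:E = (avg_nhit n)%:E.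
Proof.
rewrite /avg_nhit fineK// ge0_fin_numE; last first.
  by apply: integral_ge0 => y _; rewrite lee_fin nhit_ge0.
apply: (@le_lt_trans _ _ (\int[pi]_x 1%:E)); last first.
  by rewrite integral_cst// mul1e [ltLHS]probability_setT ltry.
apply: ge0_le_integral => //; first by move=> y _; rewrite lee_fin nhit_ge0.
  exact: measurable_nhit_EFin.
by move=> y _; rewrite lee_fin nhit_le1.
Qed.

(** With N = n + k, [nhit N x] is within [tail n] of P_k w_n(x) for every k. For fixed n, (C3)
    applied to the bounded function w_n turns the latter into its mean under [pi], where x has
    disappeared. *)
Lemma nhit_near n x e : (0 < e)%R ->
  \forall N \near \oo, (`|nhit N x - avg_nhit n| <= tail n + e)%R.
Proof.
move=> e0.
have bn : [bounded nhit n y | y in setT].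
  exists 1%R; split => // c c1 y _ /=.
  by rewrite ger0_norm ?nhit_ge0// (le_trans (nhit_le1 n y))// ltW.
have : \int[nstep P k x]_y (nhit n y)%:E @[k --> \oo] --> (avg_nhit n)%:E.
  by rewrite -integral_pi_nhit; exact: C3 (measurable_nhit n) (nhit_ge0 n) bn x.
move=> /fine_cvgP[_ /cvgrPdist_le/(_ e e0)[K _ HK]].
exists (n + K)%N => // N /= nKN.
have nN : (n <= N)%N by apply: leq_trans nKN; rewrite leq_addr.
have := HK (N - n)%N; rewrite /= leq_subRL// => /(_ nKN).
have := nhitD_dist n (N - n) x; rewrite subnKC//.
rewrite !ler_norml => /andP[? ?] /andP[? ?].
by apply/andP; split; lra.
Qed.

(** Both means approximate [nhit N point] for the same large N. *)
Lemma avg_nhit_dist n k : (`|avg_nhit n - avg_nhit k| <= tail n + tail k)%R.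
Proof.
apply/ler_addgt0Pr => e e0.
have e2 : (0 < e / 2)%R by rewrite divr_gt0.
near \oo => N.
have : (`|nhit N point - avg_nhit n| <= tail n + e / 2)%R.
  by near: N; exact: nhit_near.
have : (`|nhit N point - avg_nhit k| <= tail k + e / 2)%R.
  by near: N; exact: nhit_near.
rewrite !ler_norml => /andP[? ?] /andP[? ?].
by apply/andP; split; lra.
Unshelve. all: by end_near. Qed.

End limit.

End one_set.

Lemma tail_cvg0 : tail n @[n --> \oo] --> (0 : R)%R.
Proof.
rewrite /tail -[X in _ --> X](mulr0 defect); apply: cvgMr.
rewrite -[X in _ --> X](mul0r (1 - m)^-1%R); apply: cvgMl.
by apply: cvg_expr; rewrite ger0_norm ?(ltW m0).
Qed.

End normalized_hits.

(** * The measure ell, its positivity, and several ancestors *)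

Section quasi_stationary_measure.
Context {R : realType}.
Variables (p : probability nat R)
  (P : R.-pker measurableTypeR R ~> measurableTypeR R).
Hypothesis C1 : condition_C1 p.
Local Open Scope ereal_scope.
Notation X := (measurableTypeR R).
Notation mP := (measurable_kgiry P).
Let P1 x : kgiry P x setT = 1. Proof. exact: prob_kernel. Qed.
Notation Z := (breedn (measurable_litter p mP)).
Notation surv := (surv p mP).
Notation m := (mean p).
Let m0 : (0 < m)%R := mean_gt0 C1.
Let m1 : (m < 1)%R := mean_lt1 C1.
Variable pi : probability X R.
Hypothesis C3 : forall h : X -> R, measurable_fun setT h ->
  (forall y, (0 <= h y)%R) -> [bounded h y | y in setT] ->
  forall x : R,
  \int[nstep P n x]_y (h y)%:E @[n --> \oo] --> \int[pi]_y (h y)%:E.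

Let ma : measurable (alive : set (mseq X)) := measurable_alive.

Let mD (A : set (mseq X)) : measurable A -> measurable (A `&` alive : set (mseq X)).
Proof. by move=> mA; exact: measurableI. Qed.

Let D0 (A : set (mseq X)) : ~ (A `&` alive) [::].
Proof. by case. Qed.

Lemma measurable_breedn1 n : measurable_fun setT (fun x : X => Z n [:: x]).
Proof.
by apply: measurable_giry_codensity => // B mB; exact: measurable_breedn1_ev.
Qed.

Let scale_ge0 n : (0 <= (m ^+ n)^-1)%R.
Proof. by rewrite invr_ge0 exprn_ge0// ltW. Qed.

(** D |-> pi(w_n) is realized as a rescaled law: generation n started from one particle drawn from
    [pi], restricted to survival and divided by [m ^+ n]. *)
Definition norm_law n : {measure set (mseq X) -> \bar R} :=
  mscale (NngNum (scale_ge0 n)) (mrestr (giry_bind pi (measurable_breedn1 n)) ma).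

Lemma norm_lawE n A : measurable A ->
  norm_law n A = (avg_nhit p P (A `&` alive) pi n)%:E.
Proof.
move=> mA; rewrite -(integral_pi_nhit P C1 (mD mA) (@D0 A)).
transitivity (((m ^+ n)^-1)%:E * giry_bind pi (measurable_breedn1 n) (A `&` alive)).
  by [].
rewrite (giry_bindE pi (measurable_breedn1 n) (mD mA)) /giry_int -ge0_integralZl//.
- apply: eq_integral => x _.
  by rewrite (hitE p mP P1 (mD mA)) -EFinM mulrC.
- by apply: measurable_breedn1_ev; exact: mD.
- by rewrite lee_fin.
Qed.

Lemma norm_law_setT n : norm_law n setT < +oo.
Proof. by rewrite norm_lawE// ltry. Qed.

Lemma norm_law_dist n k (A : set (mseq X)) : measurable A ->
  (`|fine (norm_law n A) - fine (norm_law k A)| <= tail p n + tail p k)%R.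
Proof.
move=> mA; rewrite !norm_lawE//.
exact: (avg_nhit_dist C1 (mD mA) (@D0 A) C3).
Qed.

(** ell of the overview, not yet normalized; as a limit of measures carried by [alive] it ignores
    the empty list. *)
Definition yaglom : {measure set (mseq X) -> \bar R} :=
  ulim_measure norm_law_setT (tail_cvg0 C1) norm_law_dist.

Lemma yaglomP (A : set (mseq X)) : measurable A ->
  yaglom A \is a fin_num /\
  forall n, (`|fine (yaglom A) - avg_nhit p P (A `&` alive) pi n| <= tail p n)%R.
Proof.
move=> mA; have [l [lE _ lb]] := ulimP norm_law_setT (tail_cvg0 C1) norm_law_dist mA.
rewrite -[yaglom A]/(ulim norm_law A) lE; split => // n.
by have := lb n; rewrite norm_lawE.
Qed.

Lemma yaglom_setT : yaglom setT < +oo.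
Proof. by have [+ _] := yaglomP measurableT; rewrite ge0_fin_numE. Qed.

Lemma nhit_cvg (A : set (mseq X)) x : measurable A ->
  nhit p P (A `&` alive) n x @[n --> \oo] --> fine (yaglom A).
Proof.
move=> mA; have [_ yb] := yaglomP mA.
apply: (cvg_sandwich (tail_cvg0 C1) yb) => n e e0.
exact: (nhit_near C1 (mD mA) (@D0 A) C3 n x e0).
Qed.

Lemma surv_norm_cvg : (surv n / m ^+ n)%R @[n --> \oo] --> fine (yaglom setT).
Proof.
by have := @nhit_cvg setT point measurableT; rewrite setTI.
Qed.

(** In one generation q_n / m^n loses at most the fraction [defect * m ^+ n] of itself. These
    fractions are summable, so from some n on the total loss is at most one half of the value at
    n. *)
Lemma yaglom_gt0 : (0 < fine (yaglom setT))%R.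
Proof.
pose r n : R := (surv n / m ^+ n)%R.
(* One factor q_n of the quadratic error is kept and only the other is bounded by [m ^+ n]: the loss
   is proportional to [r n]. *)
have rS n : (r n <= r n.+1 + r n * (defect p * m ^+ n))%R.
  have := survS_ge mP P1 C1 n.
  have mn0 k : (0 < m ^+ k)%R by rewrite exprn_gt0.
  have rE : (r n * (defect p * m ^+ n) =
      moment2 p * (surv n * m ^+ n) / m ^+ n.+1)%R.
    rewrite /r /defect exprS invfM mulrACA mulVf ?gt_eqF// mulr1.
    rewrite [(moment2 p * (_ * _))%R]mulrA mulrACA divff ?gt_eqF// mulr1.
    by rewrite mulrCA mulrA.
  move=> h; rewrite rE [X in (X <= _)%R](_ : _ = m * surv n / m ^+ n.+1)%R; last first.
    by rewrite exprS invfM mulrACA divff ?gt_eqF// mul1r.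
  apply: (@le_trans _ _
      ((surv n.+1 + moment2 p * surv n ^+ 2) / m ^+ n.+1)%R).
    by rewrite ler_wpM2r// invr_ge0 ltW.
  rewrite mulrDl lerD2l.
  rewrite ler_wpM2r ?invr_ge0 ?(ltW (mn0 _))// ler_wpM2l ?moment2_ge0//.
  by rewrite expr2 ler_wpM2l ?surv_ge0// surv_le_mean.
have r_gt0 n : (0 < r n)%R by rewrite divr_gt0 ?surv_gt0 ?exprn_gt0.
have r_dec n k : (r (n + k)%N <= r n)%R.
  elim: k => [|k]; first by rewrite addn0.
  apply: le_trans; rewrite addnS ler_pdivrMr ?exprn_gt0//.
  rewrite exprS mulrCA divfK ?expf_neq0 ?gt_eqF//.
  exact: survS_le.
have [n tn] : exists n, (tail p n <= 1 / 2)%R.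
  have /cvgrPdist_le/(_ (1 / 2)%R)[|N _ /(_ N (leqnn N))] := tail_cvg0 C1.
    by rewrite divr_gt0.
  by rewrite sub0r normrN ler_norml => /andP[_ ?]; exists N.
(* Since r decreases, later losses can be measured against [r n]; their sum is then [r n] times the
   drift, which [tail] bounds. *)
have rk k : (r n - r n * (defect p * \sum_(j < k) m ^+ (n + j)%N) <= r (n + k)%N)%R.
  elim: k => [|k IH]; first by rewrite big_ord0 !mulr0 subr0 addn0.
  have := rS (n + k)%N; rewrite addnS big_ord_recr/=.
  have : (r (n + k)%N * (defect p * m ^+ (n + k)%N) <=
          r n * (defect p * m ^+ (n + k)%N))%R.
    by rewrite ler_wpM2r// mulr_ge0 ?defect_ge0// exprn_ge0// ltW.
  by rewrite !mulrDr; move: IH; lra.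
have rhalf k : (r n / 2 <= r (n + k)%N)%R.
  apply: le_trans (rk k).
  have : (r n * (defect p * \sum_(j < k) m ^+ (n + j)%N) <= r n * (1 / 2))%R.
    by rewrite ler_wpM2l ?(ltW (r_gt0 _))// (le_trans _ tn)// drift_le.
  by lra.
apply: (@lt_le_trans _ _ (r n / 2)%R); first by rewrite divr_gt0.
rewrite -(cvg_lim _ surv_norm_cvg)//; apply: limr_ge.
  by apply/cvg_ex; exists (fine (yaglom setT)); exact: surv_norm_cvg.
exists n => // k /= nk; rewrite -/(r k) -(subnKC nk); exact: rhalf.
Qed.

(** A bound uniform in n, which dominates the integrands in [generation_norm_cvg]. *)
Lemma breedn_norm_bound (A : set (mseq X)) n s : measurable A ->
  (0 <= fine (Z n s (A `&` alive)) / m ^+ n <= (size s)%:R)%R.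
Proof.
move=> mA; have mn : (0 < m ^+ n)%R by rewrite exprn_gt0.
rewrite divr_ge0 ?fine_ge0 ?(ltW mn)//= ler_pdivrMr//.
rewrite -lee_fin fineK; last by apply: breedn_fin => //; exact: mD.
apply: (@le_trans _ _ (Z n s alive)).
  by apply: le_measure; rewrite ?inE//; exact: mD.
apply: (le_trans (breedn_alive_le p mP P1 n s)).
by rewrite lee_fin ler_wpM2l// surv_le_mean.
Qed.

(** Several ancestors differ from a sum of single ones by at most (size s)^2 q_n^2, which vanishes
    even after division by m^n. Each ancestor then contributes ell(A), wherever it is. *)
Lemma breedn_norm_cvg (A : set (mseq X)) s : measurable A ->
  (fine (Z n s (A `&` alive)) / m ^+ n)%R @[n --> \oo] -->
  ((size s)%:R * fine (yaglom A))%R.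
Proof.
move=> mA; have mA' := mD mA.
have sumE n : \sum_(y <- s) Z n [:: y] (A `&` alive) =
    (\sum_(y <- s) hit p mP (A `&` alive) n y)%:E.
  by rewrite -sumEFin; apply: eq_bigr => y _; exact: hitE.
have bound n : (`|\sum_(y <- s) nhit p P (A `&` alive) n y -
    fine (Z n s (A `&` alive)) / m ^+ n| <= (size s)%:R ^+ 2 * m ^+ n)%R.
  have mn : (0 < m ^+ n)%R by rewrite exprn_gt0.
  have fin := breedn_fin p mP P1 n s mA'.
  have := breedn_le_sum p mP P1 mA' (@D0 A) n s.
  have := breedn_ge_sum p mP P1 mA' (@D0 A) n s.
  rewrite sumE -(fineK fin) -!EFinD !lee_fin => h1 h2.
  rewrite -mulr_suml -mulrBl normrM [X in (_ * X)%R]gtr0_norm ?invr_gt0//.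
  rewrite ler_pdivrMr//.
  apply: (@le_trans _ _ ((size s)%:R ^+ 2 * surv n ^+ 2)%R).
    by rewrite ler_norml; apply/andP; split; lra.
  rewrite -[leRHS]mulrA ler_wpM2l ?sqr_ge0//.
  by rewrite expr2 ler_pM ?surv_ge0 ?surv_le_mean.
have sum_cvg : (\sum_(y <- s) nhit p P (A `&` alive) n y)%R @[n --> \oo] -->
    ((size s)%:R * fine (yaglom A))%R.
  have -> : ((size s)%:R * fine (yaglom A) = \sum_(y <- s) fine (yaglom A))%R.
    by rewrite big_const_seq count_predT iter_addr_0 mulr_natl.
  by apply: cvg_big => [|y _]; [exact: add_continuous|exact: nhit_cvg].
have err_cvg : ((size s)%:R ^+ 2 * m ^+ n)%R @[n --> \oo] --> (0 : R)%R.
  rewrite -[X in _ --> X](mulr0 ((size s)%:R ^+ 2)%R); apply: cvgMr.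
  by apply: cvg_expr; rewrite ger0_norm ?(ltW m0).
have diff_cvg : (\sum_(y <- s) nhit p P (A `&` alive) n y -
    fine (Z n s (A `&` alive)) / m ^+ n)%R @[n --> \oo] --> (0 : R)%R.
  apply/cvgrPdist_le => e e0; near=> n.
  rewrite sub0r normrN; apply: (le_trans (bound n)).
  have : (`|0 - (size s)%:R ^+ 2 * m ^+ n| <= e)%R.
    by near: n; move/cvgrPdist_le : err_cvg; apply.
  by rewrite sub0r normrN; apply: le_trans; exact: ler_norm.
rewrite -[X in _ --> X]subr0.
rewrite (_ : (fun n => _) = (fun n => \sum_(y <- s) nhit p P (A `&` alive) n y -
  (\sum_(y <- s) nhit p P (A `&` alive) n y -
    fine (Z n s (A `&` alive)) / m ^+ n))%R).
  exact: cvgB.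
by apply/funext => n; rewrite subKr.
Unshelve. all: by end_near. Qed.

End quasi_stationary_measure.

(** * The law of a generation *)

(** The weak compositions of k into n parts: the possible family sizes when n parents have k
    children in all. *)
Fixpoint shapes (n k : nat) : seq (seq nat) :=
  if n is n'.+1 then [seq j :: ks | j <- index_iota 0 k.+1, ks <- shapes n' (k - j)]
  else if k is 0 then [:: [::]] else [::].

Lemma mem_shapes n k ks :
  (ks \in shapes n k) = (size ks == n) && (sumn ks == k).
Proof.
elim: n k ks => [|n IH] k ks.
  by case: k => [|k]; rewrite ?inE; case: ks => [|[|j] ks].
apply/allpairsPdep/andP => [[j [ks' [+ + ->]]]|[/eqP + /eqP]].
  rewrite mem_index_iota /= ltnS IH => jk /andP[/eqP -> /eqP ->].
  by rewrite eqxx subnKC.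
case: ks => // j ks [sks] /= jks.
exists j, ks; rewrite mem_index_iota IH -jks ltnS leq_addr addKn sks !eqxx.
by [].
Qed.

Lemma uniq_shapes n k : uniq (shapes n k).
Proof.
elim: n k => [|n IH] k; first by case: k.
apply: allpairs_uniq_dep => [|j _|].
- exact: iota_uniq.
- exact: IH.
- by move=> [j ks] [j' ks'] _ _ /= [-> ->].
Qed.

Section breed_box.
Context {d : measure_display} {X : measurableType d} {R : realType}.
Variables (p : probability nat R) (P : X -> giry X R).
Hypothesis mP : measurable_fun setT P.
Hypothesis P1 : forall x, P x setT = 1%E.
Local Open Scope ereal_scope.

(** The side of the box that falls to the j-th child of the i-th parent. The default [setT] keeps it
    measurable at all indices, as the branching clause requires. *)
Definition reshape_set (ks : seq nat) (Cs : seq (set X)) (i j : nat) : set X :=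
  nth setT (nth [::] (reshape ks Cs) i) j.

(* The integrand of the branching mechanism in [branching_Markov_chain]. *)
Definition breed_weight (x0 : X) (s : seq X) (ks : seq nat) (Cs : seq (set X)) : R :=
  (\prod_(i < size ks) (fine (p [set nth 0%N ks i]) *
     \prod_(j < nth 0%N ks i) fine (P (nth x0 s i) (reshape_set ks Cs i j))))%R.

Lemma measurable_reshape_set ks (Cs : seq (set X)) i j :
  (forall C, C \in Cs -> measurable C) -> measurable (reshape_set ks Cs i j).
Proof.
move=> mCs; rewrite /reshape_set.
elim: ks Cs mCs i => [|k ks IH] Cs mCs i; first by rewrite !nth_nil.
case: i => [|i] /=.
  have [jk|jk] := ltnP j (size (take k Cs)); last by rewrite nth_default.
  by apply/mCs/mem_take/mem_nth.
by apply: IH => C /mem_drop; exact: mCs.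
Qed.

Lemma litter_box_fine x (Cs : seq (set X)) : (forall C, C \in Cs -> measurable C) ->
  litter p P x (box Cs) = (fine (p [set size Cs]) *
    \prod_(j < size Cs) fine (P x (nth setT Cs j)))%:E.
Proof.
move=> mCs; rewrite litter_box// EFinM fineK ?fin_num_measure//; congr (_ * _).
elim: Cs mCs => [|C Cs IH] mCs; first by rewrite big_nil big_ord0.
rewrite big_cons big_ord_recl EFinM IH; last first.
  by move=> D DCs; apply: mCs; rewrite in_cons DCs orbT.
by rewrite fineK ?fin_num_measure//; apply: mCs; rewrite mem_head.
Qed.

(** [catp_box] cuts the box after the children of the first parent, and [shapes] follows the same
    recursion. *)
Lemma breed_box x0 (s : seq X) (Cs : seq (set X)) :
  (forall C, C \in Cs -> measurable C) ->
  breed (litter p P) s (box Cs) =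
  (\sum_(ks <- shapes (size s) (size Cs)) breed_weight x0 s ks Cs)%R%:E.
Proof.
elim: s Cs => [|x s IH] Cs mCs.
  case: Cs mCs => [|C Cs] mCs /=.
    by rewrite big_seq1 /breed_weight big_ord0 diracE mem_set.
  by rewrite big_nil diracE memNset.
rewrite -[LHS]/(catp (litter p P x) (breed (litter p P) s) (box Cs)) catp_box//.
rewrite -[shapes _ _]/[seq j :: ks | j <- index_iota 0 (size Cs).+1,
  ks <- shapes (size s) (size Cs - j)] big_allpairs_dep -sumEFin.
rewrite big_seq [RHS]big_seq; apply: eq_bigr => k.
rewrite mem_index_iota ltnS => /andP[_ kC].
have mt C : C \in take k Cs -> measurable C by move=> /mem_take; exact: mCs.
have md C : C \in drop k Cs -> measurable C by move=> /mem_drop; exact: mCs.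
rewrite litter_box_fine// IH// -EFinM size_drop mulr_sumr; congr (_%:E).
apply: eq_bigr => ks _; rewrite /breed_weight [RHS]big_ord_recl size_takel//.
Qed.

End breed_box.

Section generation_law.
Context {R : realType} {d : measure_display} {T : measurableType d}.
Variable fam : nat -> T -> seq (seq R).
Variables (p : probability nat R)
  (P : R.-pker measurableTypeR R ~> measurableTypeR R).
Variables (Pr : probability T R) (mu : point_measure R).
Hypothesis H : branching_Markov_chain fam p P Pr mu.
Local Open Scope ereal_scope.
Notation X := (measurableTypeR R).
Notation mP := (measurable_kgiry P).
Let P1 x : kgiry P x setT = 1. Proof. exact: prob_kernel. Qed.
Notation L := (litter p (kgiry P)).
Notation mL := (measurable_litter p mP).
Notation Z := (breedn mL).
Notation gen := (generation fam).

Lemma measurable_family_box n ks (B : nat -> nat -> set X) :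
  (forall i j, measurable (B i j)) -> measurable (fam n @^-1` family_box ks B).
Proof.
move=> mB; have [_ + _ _] := H; apply.
by apply: sub_sigma_algebra; exists n, ks, B.
Qed.

Lemma generation_boxE n (Cs : seq (set X)) (ks : seq nat) : sumn ks = size Cs ->
  fam n @^-1` family_box ks (reshape_set ks Cs) =
  [set w | shape (fam n w) = ks] `&` gen n @^-1` box Cs.
Proof.
move=> ksC; apply/seteqP; split=> w.
  move=> [sks h]; have [_ b] := (box_flatten_reshape (0%R : X) (fam n w) ksC).2 (conj sks h).
  by split.
by move=> [/= sks b]; have [_ h] := (box_flatten_reshape (0%R : X) (fam n w) ksC).1 (conj sks b).
Qed.

(** Measurability is given for events on families. A generation in a box has one of countably many
    shapes, and for each shape the event is a [family_box]. *)
Lemma measurable_generation n : measurable_fun setT (gen n : T -> mseq X).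
Proof.
apply: measurable_fun_mseq => // Cs mCs; rewrite setTI.
have -> : gen n @^-1` box Cs = \bigcup_ks
    (if sumn ks == size Cs then fam n @^-1` family_box ks (reshape_set ks Cs)
     else set0).
  apply/seteqP; split=> [w b|w [ks _]].
    exists (shape (fam n w)) => //.
    have sE : sumn (shape (fam n w)) = size Cs.
      by rewrite -size_flatten; exact: (box_size b).
    by rewrite sE eqxx generation_boxE.
  by case: eqP => // ksC; rewrite generation_boxE// => -[].
apply: countable_bigcupT_measurable; first exact: countableP.
move=> ks; case: eqP => // _; apply: measurable_family_box => i j.
exact: measurable_reshape_set.
Qed.

Let size_fam n w : size (fam n.+1 w) = size (gen n w).
Proof. by have [+ _ _ _] := H; apply. Qed.

Let measurable_gen_size n N : measurable [set w | size (gen n w) = N].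
Proof.
rewrite -[X in measurable X]setTI -[X in _ `&` X]/(gen n @^-1` [set s | size s = N]).
by apply: measurable_generation => //; exact: measurable_size.
Qed.

(** The branching clause prescribes every family size, a box only their sum: the event is split
    along the size N of generation n and then into the disjoint events of the finitely many possible
    shapes. *)
Lemma generationS_box n (Cs : seq (set X)) : (forall C, C \in Cs -> measurable C) ->
  Pr (gen n.+1 @^-1` box Cs) = \int[Pr]_w breed L (gen n w) (box Cs).
Proof.
move=> mCs.
have mG : measurable (gen n.+1 @^-1` box Cs).
  rewrite -[X in measurable X]setTI.
  by apply: measurable_generation => //; exact: measurable_box.
pose E N := [set w | size (gen n w) = N].
have ET : [set: T] = \bigcup_N E N.
  by apply/seteqP; split=> // w _; exists (size (gen n w)).
have tE : trivIset setT E.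
  by apply/trivIsetP => i j _ _ /eqP ij; apply/seteqP; split=> // w [];
  rewrite /E /= => -> /ij.
have mb : measurable_fun setT (fun w => breed L (gen n w) (box Cs)).
  apply: (@measurableT_comp _ _ _ _ _ _ (fun s : mseq X => breed L s (box Cs))).
    apply: measurable_giry_ev_comp; first exact: (measurable_breed mL).
    exact: measurable_box.
  exact: measurable_generation.
transitivity (\int[Pr]_w (\1_(gen n.+1 @^-1` box Cs) w)%:E).
  by rewrite integral_indic// setIT.
have mE N : measurable (E N) by exact: measurable_gen_size.
rewrite ET (ge0_integral_bigcup _ mE)//; last first.
  by apply: measurable_funTS; apply/measurable_EFinP; exact: measurable_indic.
rewrite (ge0_integral_bigcup _ mE)//; last exact: measurable_funTS.
apply: eq_eseriesr => N _.
rewrite integral_indic//.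
pose F ks := fam n.+1 @^-1` family_box ks (reshape_set ks Cs).
have mF ks : measurable (F ks).
  by apply: measurable_family_box => i j; exact: measurable_reshape_set.
have FE ks : ks \in shapes N (size Cs) ->
    F ks = [set w | shape (fam n.+1 w) = ks] `&` gen n.+1 @^-1` box Cs.
  by rewrite mem_shapes => /andP[_ /eqP ksC]; rewrite /F generation_boxE.
have -> : gen n.+1 @^-1` box Cs `&` E N =
    \big[setU/set0]_(ks <- shapes N (size Cs)) F ks.
  rewrite -bigcup_seq; apply/seteqP; split=> w.
    move=> [b /= EN]; exists (shape (fam n.+1 w)).
      rewrite /= mem_shapes size_map size_fam EN eqxx/=.
      by rewrite -size_flatten; apply/eqP; exact: (box_size b).
    rewrite FE// mem_shapes size_map size_fam EN eqxx/=.
    by rewrite -size_flatten; apply/eqP; exact: (box_size b).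
  move=> [ks /= ksS]; rewrite FE// => -[/= sks b]; split => //.
  move: ksS; rewrite mem_shapes => /andP[/eqP <- _].
  by rewrite /E /= -size_fam -sks size_map.
transitivity (\int[Pr]_(w in \big[setU/set0]_(ks <- shapes N (size Cs)) F ks) cst 1 w).
  rewrite integral_cst ?mul1e//.
  by apply: bigsetU_measurable => ks _.
rewrite ge0_integral_bigsetU//; last 2 first.
- exact: uniq_shapes.
- move=> ks ks' ksS ks'S [w []]; rewrite FE// FE//.
  by move=> [/= -> _] [/= -> _].
transitivity (\sum_(ks <- shapes N (size Cs))
    \int[Pr]_(w in E N) (breed_weight p (kgiry P) (0%R : X) (gen n w) ks Cs)%:E).
  rewrite big_seq [RHS]big_seq; apply: eq_bigr => ks ksS.
  rewrite integral_cst// mul1e.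
  (* The past event is [setT], which lies in every history as the complement of the empty set. *)
  have [_ _ _ /(_ n setT ks (reshape_set ks Cs))] := H.
  rewrite !setTI => HE; apply: (etrans (HE _ _)).
  - by move=> M [[M0 MC _] _]; rewrite -(setD0 setT); exact: MC.
  - by move=> i j; exact: measurable_reshape_set.
  move: ksS; rewrite mem_shapes => /andP[/eqP <- _].
  by apply: eq_integral => w _.
rewrite -ge0_integral_sum//.
- apply: eq_integral => w; rewrite inE => /= wN.
  by rewrite (breed_box p (kgiry P) (0%R : X))// wN -sumEFin.
- move=> ks; apply/measurable_EFinP; apply: measurable_funTS.
  apply: (@measurableT_comp _ _ _ _ _ _ (fun s : mseq X =>
    breed_weight p (kgiry P) (0%R : X) s ks Cs) setT (gen n)); last first.
    exact: measurable_generation.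
  apply: measurable_prod => i _; apply: measurable_funM => //.
  apply: measurable_prod => j _; apply: measurableT_comp => //.
  apply: (@measurableT_comp _ _ _ _ _ _
    (fun x : X => kgiry P x (reshape_set ks Cs i j)) setT
    (fun s : mseq X => nth (0%R : X) s i)); last exact: measurable_nth.
  apply: measurable_giry_ev_comp; first exact: measurable_kgiry.
  exact: measurable_reshape_set.
- move=> ks w _; rewrite lee_fin; apply: prodr_ge0 => i _.
  by rewrite mulr_ge0 ?fine_ge0// prodr_ge0// => j _; rewrite fine_ge0.
Qed.

End generation_law.

Lemma pm_of_seq_setT (R : realType) (s : seq R) :
  pm_of_seq s setT = (size s)%:R%:E.
Proof.
rewrite /= /sum_dirac /= /msum.
transitivity (\sum_(i < size s) (1%:E : \bar R))%E.
  by apply: eq_bigr => i _; exact: diracT.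
by rewrite sumEFin big_const card_ord iter_addr_0.
Qed.

Section generation_law_limit.
Context {R : realType} {d : measure_display} {T : measurableType d}.
Variable fam : nat -> T -> seq (seq R).
Variables (p : probability nat R)
  (P : R.-pker measurableTypeR R ~> measurableTypeR R).
Variables (Pr : probability T R) (mu : point_measure R).
Hypothesis H : branching_Markov_chain fam p P Pr mu.
Local Open Scope ereal_scope.
Notation X := (measurableTypeR R).
Notation mP := (measurable_kgiry P).
Let P1 x : kgiry P x setT = 1. Proof. exact: prob_kernel. Qed.
Notation L := (litter p (kgiry P)).
Notation mL := (measurable_litter p mP).
Notation Z := (breedn mL).
Notation gen := (generation fam).

Definition gen_law n : giry (mseq X) R := giry_map (measurable_generation H n) Pr.

(** [generationS_box] gives equality on boxes, hence of the two measures. *)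
Lemma giry_int_gen_lawS n (F : mseq X -> \bar R) :
  measurable_fun setT F -> (forall s, 0 <= F s) ->
  giry_int (gen_law n.+1) F =
  giry_int (gen_law n) (fun s => giry_int (breed L s) F).
Proof.
move=> mF F0; rewrite -(giry_int_bind (gen_law n) (measurable_breed mL) mF F0).
apply: eq_measure_integral => A mA _.
apply: eq_measure_mseq => // [Cs mCs|]; last first.
  apply: (@le_lt_trans _ _ 1); last exact: ltry.
  exact: (@sprobability_setT _ _ _ (gen_law n.+1)).
have mb : measurable (box Cs : set (mseq X)) by exact: measurable_box.
rewrite [RHS](giry_bindE (gen_law n) (measurable_breed mL) mb).
rewrite (giry_int_map (measurable_generation H n))//; last first.
  by apply: measurable_giry_ev_comp => //; exact: (measurable_breed mL).
exact: (generationS_box H n mCs).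
Qed.

Lemma giry_int_gen_law n (F : mseq X -> \bar R) :
  measurable_fun setT F -> (forall s, 0 <= F s) ->
  giry_int (gen_law n) F =
  giry_int (gen_law 0) (fun s => giry_int (Z n s) F).
Proof.
elim: n F => [|n IH] F mF F0.
  by apply: eq_integral => s _; rewrite giry_int_ret.
rewrite giry_int_gen_lawS// IH; last 2 first.
- exact: (measurable_giry_int_breed mL).
- by move=> s; exact: giry_int_ge0.
by apply: eq_integral => s _; rewrite giry_int_breednSr.
Qed.

Lemma generation_prob n (A : set (mseq X)) : measurable A ->
  Pr (gen n @^-1` A) = \int[Pr]_w Z n (gen 0 w) A.
Proof.
move=> mA; have mF : measurable_fun setT (EFin \o \1_A : mseq X -> \bar R).
  by apply/measurable_EFinP; exact: measurable_indic.
have F0 t : 0 <= (EFin \o \1_A : mseq X -> \bar R) t by rewrite lee_fin.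
rewrite -[LHS]/(gen_law n A) -giry_int_indic// giry_int_gen_law//.
rewrite (giry_int_map (measurable_generation H 0))//.
- by apply: eq_integral => w _ /=; rewrite giry_int_indic.
- exact: measurable_giry_int_breedn.
- by move=> s; exact: giry_int_ge0.
Qed.

Lemma generation0_size :
  {ae Pr, forall w, (size (gen 0 w))%:R = fine (mu setT) :> R}.
Proof.
have [_ _ + _] := H; apply: filterS => w /(_ setT measurableT) <-.
by rewrite /Zn pm_of_seq_setT.
Qed.

Variable pi : probability X R.
Hypothesis C1 : condition_C1 p.
Hypothesis C3 : forall h : X -> R, measurable_fun setT h ->
  (forall y, (0 <= h y)%R) -> [bounded h y | y in setT] ->
  forall x : R,
  \int[nstep P n x]_y (h y)%:E @[n --> \oo] --> \int[pi]_y (h y)%:E.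

(** Generation 0 is random as a list, but almost surely it has mu(R) entries. The limit for a fixed
    list depends on its size only, and dominated convergence carries it under the integral. *)
Lemma generation_norm_cvg (A : set (mseq X)) : measurable A ->
  (fine (Pr (gen n @^-1` (A `&` alive))) / mean p ^+ n)%R @[n --> \oo] -->
  (fine (mu setT) * fine (yaglom C1 C3 A))%R.
Proof.
move=> mA; have mA' : measurable (A `&` alive : set (mseq X)).
  by apply: measurableI => //; exact: measurable_alive.
have mn n : (0 < mean p ^+ n)%R by rewrite exprn_gt0// mean_gt0.
pose f n w := (fine (Z n (gen 0 w) (A `&` alive)) / mean p ^+ n)%R%:E.
have fE n w : f n w = ((mean p ^+ n)^-1)%:E * Z n (gen 0 w) (A `&` alive).
  by rewrite /f EFinM fineK ?(breedn_fin p mP P1)// muleC.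
have mZ n : measurable_fun setT (fun w => Z n (gen 0 w) (A `&` alive)).
  apply: (@measurableT_comp _ _ _ _ _ _ (fun s : mseq X => Z n s (A `&` alive))
    setT (gen 0)); first exact: measurable_breedn_ev.
  exact: (measurable_generation H).
have intf n : \int[Pr]_w f n w =
    (fine (Pr (gen n @^-1` (A `&` alive))) / mean p ^+ n)%R%:E.
  under eq_integral do rewrite fE.
  rewrite ge0_integralZl//; last by rewrite lee_fin invr_ge0 ltW.
  by rewrite -generation_prob// EFinM fineK ?fin_num_measure// 1?muleC//;
    rewrite -[X in measurable X]setTI; exact: (measurable_generation H).
have [] := @dominated_convergence _ _ _ Pr setT measurableT f
  (fun=> (fine (mu setT) * fine (yaglom C1 C3 A))%R%:E)
  (fun=> (fine (mu setT))%:E).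
- move=> n; rewrite (_ : f n = fun w =>
    ((mean p ^+ n)^-1)%:E * Z n (gen 0 w) (A `&` alive)).
    exact: measurable_funeM.
  by apply/funext => w; rewrite fE.
- exact: measurable_cst.
- have := generation0_size; apply: filterS => w <- _.
  apply: cvg_EFin; first exact: nearW.
  have h := @breedn_norm_cvg _ _ _ C1 _ C3 A (gen 0 w) mA.
  exact: h.
- exact: finite_measure_integrable_cst.
- have := generation0_size; apply: filterS => w <- n _.
  have /andP[? ?] := breedn_norm_bound P C1 n (gen 0 w) mA.
  by rewrite /f lee_fin ger0_norm.
move=> _ _; under eq_fun do rewrite intf.
rewrite integral_cst// [X in _ * X]probability_setT mule1.
by move=> /fine_cvgP[].
Qed.

End generation_law_limit.

(** * The weak topology on point measures *)

Lemma Rintegral_pm_of_seq (R : realType) (s : seq R) (f : R -> R) :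
  measurable_fun setT f ->
  \int[(pm_of_seq s : point_measure R)]_x f x = \sum_(i < size s) f s`_i.
Proof.
move=> mf; have mE : measurable_fun setT (EFin \o f) by exact/measurable_EFinP.
have sumE (g : R -> \bar R) : measurable_fun setT g -> (forall x, 0 <= g x)%E ->
    (\int[(pm_of_seq s : point_measure R)]_x g x = \sum_(i < size s) g s`_i)%E.
  move=> mg g0; rewrite -[LHS]/(\int[msum (fun i => \d_(s`_i : measurableTypeR R)) (size s)]_x g x)%E.
  rewrite ge0_integral_measure_sum//; apply: eq_bigr => i _.
  by rewrite integral_dirac// diracT mul1e.
rewrite /Rintegral integralE !sumE//; last 2 first.
- exact: measurable_funeneg.
- exact: measurable_funepos.
have fE : forall x, ((EFin \o f)^\+ x - (EFin \o f)^\- x)%E = (f x)%:E.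
  by move=> x; rewrite -[LHS]/(((EFin \o f)^\+ \- (EFin \o f)^\-)%E x) -funeposneg.
have pE x : (EFin \o f)^\+%E x = (Num.max (f x) 0)%:E by rewrite funeposE /= EFin_max.
have nE x : (EFin \o f)^\-%E x = (Num.max (- f x) 0)%:E by rewrite funenegE /= EFin_max.
under eq_bigr do rewrite pE.
under [X in (_ - X)%E]eq_bigr do rewrite nE.
rewrite !sumEFin -EFinB/= -sumrB; apply: eq_bigr => i _.
by apply: EFin_inj; rewrite EFinB -pE -nE fE.
Qed.

Section point_measure_topology.
Context {R : realType}.
Notation N := (nz_point_measure R).
Notation S := (mseq (measurableTypeR R)).

(* [nzpm [::]] is the junk value [point]. *)
Definition nzpm (s : seq R) : N := insubd (point : N) (pm_of_seq s).

Definition pairing (nu : N) : {ptws Cb R -> R} := pm_integral (nz_measure nu).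

(** The topology is initial twice, along [nz_measure] and along [pm_integral]; [pairing] is the
    composite. *)
Lemma open_nzP (U : set N) : open U <-> exists2 G : set {ptws Cb R -> R},
  open G & pairing @^-1` G = U.
Proof.
split=> [[V [G oG <-] <-]|[G oG <-]]; first by exists G.
by exists (@pm_integral R @^-1` G) => //; exists G.
Qed.

Lemma pairing_continuous : continuous pairing.
Proof. by apply/continuousP => G oG; apply/open_nzP; exists G. Qed.

Lemma nzpmE (s : seq R) : (0 < size s)%N -> nz_measure (nzpm s) = pm_of_seq s.
Proof.
move=> s0; rewrite /nzpm; have h : pm_of_seq s setT != 0%E.
  by rewrite pm_of_seq_setT eqe pnatr_eq0 -lt0n.
have -> : pm_of_seq s = val (NzPointMeasure h) by [].
by rewrite valKd.
Qed.

Lemma pairing_nzpm (s : seq R) : (0 < size s)%N ->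
  forall f : Cb R, pairing (nzpm s) f = \sum_(i < size s) f s`_i.
Proof.
move=> s0 f; rewrite /pairing /pm_integral nzpmE// Rintegral_pm_of_seq//.
by apply: continuous_measurable_fun; exact: Cb_continuous.
Qed.

Lemma eq_pairing (nu nu' : N) :
  (forall A : set (measurableTypeR R), measurable A -> nu A = nu' A) ->
  pairing nu = pairing nu'.
Proof.
move=> h; apply/funext => f; rewrite /pairing /pm_integral /Rintegral.
by congr fine; apply: eq_measure_integral => A mA _; exact: h.
Qed.

Definition nbox (s : seq R) (e : R) : set S :=
  [set t | size t = size s /\ forall i, (i < size s)%N -> `|t`_i - s`_i| < e].

(** This is continuity of [nzpm] when lists of equal length are compared entry by entry: each
    pairing is a finite sum of values of a continuous function. *)
Lemma nzpm_nbox (s : seq R) (U : set N) : (0 < size s)%N -> open U ->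
  U (nzpm s) -> exists2 e, 0 < e & nbox s e `<=` nzpm @^-1` U.
Proof.
move=> s0 /open_nzP[G oG <-] Gs.
(* The neighbourhood filter of [s] for this comparison. *)
pose F : set_system S := filter_from [set e : R | 0 < e] (nbox s).
have FF : Filter F.
  apply: filter_from_filter; first by exists 1 => /=.
  move=> e e' /= e0 e'0; exists (Num.min e e'); first by rewrite /= lt_min e0.
  move=> t [ts h]; split; split => // i /h; rewrite lt_min => /andP[? ?] //.
have Fsize : F [set t | size t = size s].
  by exists 1 => //= t [].
have Fnth i : (i < size s)%N -> nth 0 t i @[t --> F] --> s`_i.
  move=> si; apply/cvgrPdist_lt => e e0; exists e => // t [_ /(_ i si)].
  by rewrite distrC.
have FJ : pairing (nzpm t) @[t --> F] --> pairing (nzpm s).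
  (* Convergence in the pointwise topology is tested one coordinate [f] at a time. *)
  rewrite cvg_sup => f; rewrite cvg_image; last first.
    by rewrite eqEsubset; split=> v // _; exists (cst v).
  have Ff : pairing (nzpm t) f @[t --> F] --> pairing (nzpm s) f.
    rewrite (pairing_nzpm s0).
    have : \sum_(i < size s) f (nth 0 t i) @[t --> F] --> \sum_(i < size s) f s`_i.
      apply: cvg_big => [|i _]; first exact: add_continuous.
      apply: (cvg_comp (fun t : S => nth 0 t i) (Cb_fun f) (Fnth i (ltn_ord i))).
      exact: Cb_continuous.
    apply: cvg_trans; apply: near_eq_cvg.
    move: Fsize; apply: filterS => t /= ts.
    by rewrite pairing_nzpm ts.
  move=> W /Ff; rewrite /nbhs/= => FW.
  exists ((fun g => g f) @^-1` W) => //.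
  by rewrite eqEsubset; split => [v [g Wg <-]//|v Wv]; exists (cst v).
have [e e0 he] := FJ G (open_nbhs_nbhs (conj oG Gs)).
by exists e.
Qed.

End point_measure_topology.

(** * Countable approximation of open sets of point measures *)

Section rational_boxes.
Context {R : realType}.
Notation N := (nz_point_measure R).
Notation S := (mseq (measurableTypeR R)).

Definition qbox (c : seq rat * nat) : set S :=
  nbox [seq ratr q | q <- c.1] (c.2.+1%:R^-1 : R).

Lemma measurable_nbox (s : seq R) e : measurable (nbox s e : set S).
Proof.
pose B (x : R) : set (measurableTypeR R) := [set y | `|y - x| < e].
have -> : nbox s e = box [seq B x | x <- s].
  apply/seteqP; split=> t.
    move=> [ts h]; apply/(boxP (0 : R)); rewrite size_map; split=> // i si.
    by rewrite (nth_map 0)//; exact: h.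
  move=> /(boxP (0 : R)); rewrite size_map => -[ts h]; split=> // i si.
  by have := h i si; rewrite (nth_map 0).
apply: measurable_box => _ /mapP[x _ ->].
have -> : B x = ball x e by apply/seteqP; split=> y; rewrite /B /ball /= distrC.
exact: measurable_ball.
Qed.

Lemma qbox_nbox (s : seq R) e : 0 < e ->
  exists c, [/\ qbox c s, qbox c `<=` nbox s e & size c.1 = size s].
Proof.
move=> e0; have [j je] : exists j : nat, (j.+1%:R^-1 : R) <= e / 2.
  have /cvgrPdist_le/(_ (e / 2))[|j _ /(_ j (leqnn j))] := @cvg_harmonic R.
    by rewrite divr_gt0.
  by rewrite sub0r normrN ger0_norm ?harmonic_ge0// => ?; exists j.
(* With centres within d of the entries and d <= e / 2, a list in the rational box is within 2 d <=
   e of [s]. *)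
set d : R := j.+1%:R^-1 in je; have d0 : 0 < d by rewrite invr_gt0.
have /choice[h hh] (x : R) : exists q : rat, `|x - ratr q| < d.
  have [|q] := @rat_in_itvoo R (x - d) (x + d); first by lra.
  rewrite in_itv/= => /andP[? ?]; exists q.
  by rewrite ltr_norml; apply/andP; split; lra.
have sE i : (i < size s)%N -> [seq ratr q | q <- [seq h x | x <- s]]`_i = ratr (h s`_i) :> R.
  by move=> si; rewrite (nth_map 0) ?size_map// (nth_map 0).
exists ([seq h x | x <- s], j); split; last by rewrite size_map.
- split; first by rewrite !size_map.
  by move=> i; rewrite !size_map => si; rewrite sE.
- move=> t [ts ht]; rewrite !size_map in ts ht; split=> // i si.
  have := ht i si; rewrite sE//= -/d; have := hh s`_i.
  rewrite !ltr_norml => /andP[? ?] /andP[? ?].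
  by apply/andP; split; lra.
Qed.

Lemma nzpm_qbox (s : seq R) (U : set N) : (0 < size s)%N -> open U ->
  U (nzpm s) -> exists c, [/\ (0 < size c.1)%N, qbox c s & qbox c `<=` nzpm @^-1` U].
Proof.
move=> s0 oU Us; have [e e0 eU] := nzpm_nbox s0 oU Us.
have [c [cs ce sc]] := qbox_nbox s e0; exists c; split; rewrite ?sc//.
exact: subset_trans ce eU.
Qed.

(** Apart from the empty list, which goes to the junk value, an open set pulls back to the union of
    the nonempty-list rational boxes inside its preimage: a countable union, whatever the open
    set. *)
Lemma measurable_nzpm : measurable_fun setT (nzpm : S -> nz_borel R).
Proof.
apply: (@measurability _ _ S (nz_borel R) setT nzpm (@open N)) => //.
move=> _ [U oU <-]; rewrite setTI.
pose good c := (0 < size c.1)%N /\ qbox c `<=` nzpm @^-1` U.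
have -> : nzpm @^-1` U = [set s : S | size s = 0%N /\ U (nzpm [::])] `|`
    \bigcup_c (if pselect (good c) then qbox c else set0).
  apply/seteqP; split=> [s Us|s].
    have [s0|] := posnP (size s).
      by left; split=> //; move: Us; rewrite (size0nil s0).
    move=> s0; right; have [c [c0 cs cU]] := nzpm_qbox s0 oU Us.
    by exists c => //; case: pselect => // -[].
  move=> [[s0 U0]|[c _]]; first by rewrite (size0nil s0).
  by case: pselect => // -[_ cU] /cU.
apply: measurableU.
  exact: (measurable_sizeP (fun k => k = 0%N /\ U (nzpm [::]))).
apply: countable_bigcupT_measurable; first exact: countableP.
by move=> c; case: pselect => [g|g] /=; [exact: measurable_nbox|].
Qed.

Lemma continuous_measurable_nz (f : N -> R) : continuous f ->
  measurable_fun setT (f : nz_borel R -> R).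
Proof.
move=> cf; apply: (measurability _ (RGenOInfty.measurableE R)) => //.
move=> _ [_ [x ->] <-]; rewrite setTI; apply: sub_sigma_algebra.
have -> : `]x, +oo[%classic = [set y : R | x < y].
  by apply/seteqP; split=> y /=; rewrite in_itv/= andbT.
by move/continuousP : cf; apply; exact: open_gt.
Qed.

Hypothesis dirac_sums : forall nu : N, exists2 s : seq R, (0 < size s)%N &
  forall A : set (measurableTypeR R), measurable A -> nu A = pm_of_seq s A.

(* One separating function is chosen for each rational box on which some
   function works: this reduces the family of all of them to a countable one. *)
Lemma open_cozero (U : set N) : open U ->
  exists g : nat -> N -> R, [/\ forall i, continuous (g i),
    forall i nu, 0 <= g i nu & forall nu, U nu <-> exists i, 0 < g i nu].
Proof.
(* The function [h c] below is positive on all of the rational box [c] whenever some admissible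
   function is; otherwise it may be 0. *)
move=> /open_nzP[G oG <-].
have /choice[h hP] (c : seq rat * nat) : exists h : {ptws Cb R -> R} -> R,
    [/\ continuous h, forall v, 0 <= h v, forall v, 0 < h v -> G v &
     (exists h' : {ptws Cb R -> R} -> R, [/\ continuous h', forall v, 0 <= h' v,
       forall v, 0 < h' v -> G v &
       forall s, qbox c s -> 0 < h' (pairing (nzpm s))]) ->
     forall s, qbox c s -> 0 < h (pairing (nzpm s))].
  have [[h' [h1 h2 h3 h4]]|n] := pselect (exists h' : {ptws Cb R -> R} -> R,
      [/\ continuous h', forall v, 0 <= h' v,
       forall v, 0 < h' v -> G v &
       forall s, qbox c s -> 0 < h' (pairing (nzpm s))]).
    by exists h'; split.
  exists (fun=> 0); split => //; first by move=> ?; exact: cst_continuous.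
  by move=> v; rewrite ltxx.
exists (fun i nu => if unpickle i is Some c then h c (pairing nu) else 0); split.
- move=> i; case: (unpickle i) => [c|]; last by move=> ?; exact: cst_continuous.
  have [hc _ _ _] := hP c; move=> nu; apply: continuous_comp; last exact: hc.
  exact: pairing_continuous.
- move=> i nu; case: (unpickle i) => [c|//].
  by have [_ + _ _] := hP c; apply.
move=> nu; split; last first.
  move=> [i]; case: (unpickle i) => [c|]; last by rewrite ltxx.
  by have [_ _ + _] := hP c; apply.
move=> Gnu; have [s s0 nus] := dirac_sums nu.
have Jnu : pairing nu = pairing (nzpm s).
  by apply: eq_pairing => A mA; rewrite nus// nzpmE.
have Gs : G (pairing (nzpm s)) by rewrite -Jnu.
(* Complete regularity separates the given point from the complement of [G]; [1 - f] is then
   positive at the point and zero off [G]. *)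
have := @uniform_completely_regular R _ (pairing (nzpm s) : {ptws Cb R -> R}) (~` G).
move=> /(_ (open_closedC oG) (fun n => n Gs)).
move=> /(@uniform_separatorP _ R)[f [cf f01 f0 f1]].
pose h' v := 1 - f v.
have h'0 v : 0 <= h' v.
  by have : range f (f v) by []; move/f01; rewrite /= in_itv/= subr_ge0 => /andP[].
have h'c : continuous h'.
  by move=> v; apply: continuousB; [exact: cst_continuous|exact: cf].
have h'G v : 0 < h' v -> G v.
  move=> hv; apply: contrapT => nG; move: hv.
  have -> : h' v = 0 by rewrite /h' (f1 (f v)) ?subrr//; exists v.
  by rewrite ltxx.
have h's : 0 < h' (pairing (nzpm s)).
  by rewrite /h' (f0 (f _)) ?subr0//; exists (pairing (nzpm s)).
have oW : open (pairing @^-1` [set v | 0 < h' v]).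
  apply/open_nzP; exists [set v | 0 < h' v] => //.
  by move/continuousP : h'c => /(_ _ (@open_gt _ 0)).
(* The set where [h'] is positive contains a rational box around [s], so the function chosen for
   that box is positive at [nu]. *)
have [c [c0 cs cW]] := nzpm_qbox s0 oW h's.
exists (pickle c); rewrite pickleK Jnu.
by have [_ _ _ +] := hP c; apply => //; exists h'; split.
Qed.

End rational_boxes.

Section continuous_tests.
Context {R : realType}.
Notation N := (nz_point_measure R).
Hypothesis dirac_sums : forall nu : N, exists2 s : seq R, (0 < size s)%N &
  forall A : set (measurableTypeR R), measurable A -> nu A = pm_of_seq s A.

(** With g_i from [open_cozero], the minimum of 1 and k times the sum of the first k functions
    reaches 1 for large k at each point of U, and stays 0 elsewhere. *)
Lemma open_limit_tests (U : set N) : open U ->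
  exists f : nat -> N -> R, [/\ forall k, continuous (f k),
    forall k nu, 0 <= f k nu <= 1 &
    forall nu, f k nu @[k --> \oo] --> (\1_U nu : R)].
Proof.
move=> /(open_cozero dirac_sums)[g [gc g0 gU]].
pose sg k nu := \sum_(i < k) g i nu.
have sg0 k nu : 0 <= sg k nu by apply: sumr_ge0 => i _.
exists (fun k nu => Num.min 1 (k%:R * sg k nu)); split.
- move=> k nu; apply: (@continuous_min _ _ (fun=> 1) (fun nu => k%:R * sg k nu)).
    exact: cst_continuous.
  apply: continuousM; first exact: cst_continuous.
  apply: (@cvg_big _ _ _ _ _ _ _ (nbhs nu)) => [|i _].
    exact: add_continuous.
  exact: gc.
- by move=> k nu; rewrite le_min ler01 mulr_ge0//= ge_min lexx.
move=> nu; have [Unu|nUnu] := pselect (U nu); last first.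
  rewrite indicE memNset//; apply: cvg_near_cst; apply: nearW => k.
  rewrite /sg big1 ?mulr0; first by rewrite min_r.
  move=> i _; apply/eqP; rewrite eq_le g0 andbT leNgt; apply/negP => gi.
  by apply: nUnu; apply/gU; exists i.
rewrite indicE mem_set//; apply: cvg_near_cst.
have [i gi] := (gU nu).1 Unu.
near=> k; rewrite min_l//.
have ik : (i < k)%N by near: k; exact: nbhs_infty_gt.
apply: (@le_trans _ _ (k%:R * g i nu)); last first.
  rewrite ler_wpM2l// /sg (bigD1 (Ordinal ik))//= lerDl.
  by apply: sumr_ge0 => ? _.
rewrite -ler_pdivrMr// div1r.
by near: k; exact: nbhs_infty_ger.
Unshelve. all: by end_near. Qed.

(** Open sets form a pi-system, and on each of them dominated convergence along [open_limit_tests]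
    identifies the two probabilities. *)
Lemma continuous_tests_unique (Q Q' : probability (nz_borel R) R) :
  (forall f : N -> R, continuous f -> [bounded f nu | nu in setT] ->
    \int[Q]_nu f nu = \int[Q']_nu f nu) ->
  forall A : set (nz_borel R), measurable A -> Q A = Q' A.
Proof.
move=> QQ'; apply: (@measure_unique _ R (nz_borel R) (@open N) (fun=> setT)) => //.
- by move=> A B; exact: openI.
- by move=> _; exact: openT.
- by rewrite bigcup_const//; exists 0%N.
- move=> U oU.
  have [f [fc f01 fU]] := open_limit_tests oU.
  have mU : measurable (U : set (nz_borel R)) by exact: sub_sigma_algebra.
  have mf k : measurable_fun setT (f k : nz_borel R -> R).
    exact: continuous_measurable_nz.
  have intU (m : probability (nz_borel R) R) :
      (\int[m]_nu (f k nu)%:E)%E @[k --> \oo] --> m U.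
    have -> : m U = (\int[m]_nu (\1_U nu)%:E)%E by rewrite integral_indic// setIT.
    apply: (@dominated_cvg _ _ _ m setT measurableT _ _ (fun=> 1%E)) => //.
    - by move=> k; exact/measurable_EFinP.
    - by move=> nu _; apply: cvg_EFin; [exact: nearW|exact: fU].
    - exact: finite_measure_integrable_cst.
    - by move=> k nu _; have /andP[? ?] := f01 k nu; rewrite lee_fin ger0_norm.
  apply: (cvg_unique _ (intU Q)) => //.
  rewrite (_ : (fun k => _) = (fun k => \int[Q']_nu (f k nu)%:E)%E); first exact: intU.
  apply/funext => k.
  have bf : [bounded f k nu | nu in setT].
    exists 1; split => // c c1 nu _ /=; have /andP[? ?] := f01 k nu.
    by rewrite ger0_norm// (le_trans _ (ltW c1)).
  have int (m : probability (nz_borel R) R) :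
      (\int[m]_nu (f k nu)%:E)%E = (\int[m]_nu f k nu)%:E.
    rewrite fineK//; apply: integrable_fin_num => //.
    apply: measurable_bounded_integrable => //.
    by rewrite (le_lt_trans (probability_le1 m measurableT))// ltry.
  by rewrite !int QQ'.
- move=> _; apply: (@le_lt_trans _ _ 1%E); last exact: ltry.
  exact: probability_le1.
Qed.

End continuous_tests.

(** * Change of variables for rescaled and restricted measures *)

Section change_of_variables.
Context {R : realType} {d d' : measure_display}.
Context {T : measurableType d} {T' : measurableType d'}.

Lemma ge0_integral_mrestr (rho : {measure set T -> \bar R}) (D : set T)
    (mD : measurable D) (g : T -> \bar R) :
  measurable_fun setT g -> (forall x, 0 <= g x)%E ->
  (\int[mrestr rho mD]_x g x = \int[rho]_(x in D) g x)%E.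
Proof.
move=> mg g0.
have rD0 : mrestr rho mD (~` D) = 0%E.
  by rewrite -[LHS]/(rho (~` D `&` D)) setICl measure0.
rewrite (ge0_negligible_integral (mu := mrestr rho mD) (measurableC mD))//.
rewrite setDE setCK setTI; apply: eq_measure_integral => A mA AD.
by rewrite -[LHS]/(rho (A `&` D)) (setIidl AD).
Qed.

Section transfer.
Variables (nu : {measure set T' -> \bar R}) (rho : {measure set T -> \bar R}).
Variables (phi : T -> T') (D : set T) (c : R).
Hypotheses (c0 : 0 <= c) (mD : measurable D) (mphi : measurable_fun setT phi).
Hypothesis nuE : forall A, measurable A ->
  nu A = (c%:E * rho (phi @^-1` A `&` D))%E.

Lemma ge0_integral_transfer (g : T' -> \bar R) :
  measurable_fun setT g -> (forall x, 0 <= g x)%E ->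
  (\int[nu]_x g x = c%:E * \int[rho]_(w in D) g (phi w))%E.
Proof.
move=> mg g0.
pose k := NngNum c0.
unshelve epose (m := pushforward (mscale k (mrestr rho mD)) phi :
  {measure set T' -> \bar R}); first exact: mphi.
transitivity (\int[m]_x g x)%E.
  by apply: eq_measure_integral => A mA _; rewrite nuE.
transitivity (\int[mscale k (mrestr rho mD)]_w g (phi w))%E.
  exact: (ge0_integral_pushforward mphi (mscale k (mrestr rho mD)) measurableT mg).
have mgphi : measurable_fun setT (fun w => g (phi w)) by exact: measurableT_comp.
by rewrite ge0_integral_mscale// ge0_integral_mrestr.
Qed.

Hypothesis rhoT : (rho setT < +oo)%E.

(** The nonnegative case is applied to f + M for a bound M of |f|, and the integral of the constant
    is then subtracted on both sides. *)
Lemma Rintegral_transfer (f : T' -> R) :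
  measurable_fun setT f -> [bounded f x | x in setT] ->
  \int[nu]_x f x = c * \int[rho]_(w in D) f (phi w).
Proof.
move=> mf bf; have := bf; move=> [M' [_ /(_ (M' + 1))/=]]; rewrite ltrDl ltr01.
move=> /(_ isT) fM'; set M := M' + 1 in fM'.
have {fM'} fM x : `|f x| <= M by exact: fM'.
have rhoD : (rho D < +oo)%E by apply: le_lt_trans rhoT; apply: le_measure; rewrite ?inE.
have nuT : (nu setT < +oo)%E.
  rewrite nuE// preimage_setT setTI; apply: lte_mul_pinfty; rewrite ?lee_fin//.
have mfphi : measurable_fun D (fun w => f (phi w)).
  by apply: measurable_funTS; exact: measurableT_comp.
have bcst U (A : set U) : [bounded M | x in A].
  by exists `|M|; split => // r Mr x _; exact: ltW.
have ifphi : rho.-integrable D (EFin \o (fun w => f (phi w))).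
  apply: measurable_bounded_integrable => //.
  by exists M; split; [exact: num_real|move=> r Mr w _; exact: le_trans (fM _) (ltW Mr)].
have if_ : nu.-integrable setT (EFin \o f) by exact: measurable_bounded_integrable.
have iM : nu.-integrable setT (EFin \o cst M) by exact: measurable_bounded_integrable.
have iM' : rho.-integrable D (EFin \o cst M) by exact: measurable_bounded_integrable.
have eqM : \int[nu]_x (f x + M) = c * \int[rho]_(w in D) (f (phi w) + M).
  rewrite /Rintegral ge0_integral_transfer ?fineM//.
  - rewrite integrable_fin_num//.
    rewrite (_ : (fun w => _) = (EFin \o (fun w => f (phi w))) \+ (EFin \o cst M))%E//.
    exact: integrableD.
  - by apply/measurable_EFinP; exact: measurable_funD.
  - by move=> x; rewrite lee_fin; have := fM x; rewrite ler_norml => /andP[? ?]; lra.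
have : \int[nu]_x M = c * \int[rho]_(w in D) M.
  rewrite !Rintegral_cst// nuE// preimage_setT setTI fineM// ?ge0_fin_numE//.
  by rewrite mulrCA.
move: eqM; rewrite (RintegralD measurableT if_ iM) (RintegralD mD ifphi iM').
rewrite mulrDr => + e2.
by rewrite e2 => /addIr.
Qed.

End transfer.
End change_of_variables.

(** * Convergence of the conditional laws *)

Lemma ae_exists (R : realType) (d : measure_display) (T : measurableType d)
    (Pr : probability T R) (A : T -> Prop) :
  {ae Pr, forall w, A w} -> exists w, A w.
Proof.
move=> [B [mB B0 AB]]; apply: contrapT => nA.
have BT : B = setT by apply/seteqP; split=> // w _; apply: AB => Aw; apply: nA; exists w.
by have := probability_setT Pr; rewrite -BT B0 => /eqP; rewrite eqe eq_sym oner_eq0.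
Qed.

(* A point measure is a sum of Dirac masses because a chain can be started from
   it. *)
Lemma chain_dirac_sums (R : realType) (d : measure_display) (T : measurableType d)
    (fam : nat -> T -> seq (seq R)) (p : probability nat R)
    (P : R.-pker measurableTypeR R ~> measurableTypeR R)
    (Pr : probability T R) (nu : nz_point_measure R) :
  branching_Markov_chain fam p P Pr nu ->
  exists2 s : seq R, (0 < size s)%N &
    forall A : set (measurableTypeR R), measurable A -> nu A = pm_of_seq s A.
Proof.
move=> [_ _ /ae_exists[w nuE] _]; exists (generation fam 0 w).
  have := nz_neq0 nu; rewrite -nuE// pm_of_seq_setT.
  by rewrite eqe pnatr_eq0 lt0n.
by move=> A mA; rewrite -nuE.
Qed.

Section conditional_limit.
Context {R : realType}.
Variables (p : probability nat R)
  (P : R.-pker measurableTypeR R ~> measurableTypeR R) (pi : probability (measurableTypeR R) R).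
Hypothesis C1 : condition_C1 p.
Hypothesis C3 : forall h : measurableTypeR R -> R, measurable_fun setT h ->
  (forall y, 0 <= h y) -> [bounded h y | y in setT] ->
  forall x : R,
  (\int[nstep P n x]_y (h y)%:E @[n --> \oo] --> \int[pi]_y (h y)%:E)%E.
Notation yag := (yaglom C1 C3).
Let r := fine (yag setT).
Let r0 : 0 < r := yaglom_gt0 C1 C3.
Let rV0 : 0 <= r^-1. Proof. by rewrite invr_ge0 ltW. Qed.

Lemma yaglom_probability : exists Q : probability (nz_borel R) R,
  forall A : set (nz_borel R), measurable A ->
    Q A = (r^-1%:E * yag (nzpm @^-1` A))%E.
Proof.
unshelve epose (m := pushforward yag
  (nzpm : mseq (measurableTypeR R) -> nz_borel R) :
  {measure set (nz_borel R) -> \bar R}); first exact: measurable_nzpm.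
have mT : m setT = r%:E.
  by rewrite /r fineK// (yaglomP C1 C3 measurableT).1.
exists (mnormalize m \d_(point : nz_borel R)) => A mA.
transitivity (m A * (fine (m setT))^-1%:E)%E; last by rewrite mT muleC.
(* [mnormalize] falls back on the Dirac mass if the total mass is 0 or infinite; here it is the
   positive real r. *)
rewrite -[LHS]/((if (m setT == 0) || (m setT == +oo) then
  fun U => \d_(point : nz_borel R) U else
  fun U => m U * (fine (m setT))^-1%:E) A)%E.
by rewrite mT eqe gt_eqF.
Qed.

(** Numerator and denominator, both divided by m^n, converge to k times the integral of [F] under
    ell and to k r, where k = mu(R): the initial number of particles leaves the ratio. *)
Lemma conditional_law_cvg_yaglom (d : measure_display) (T : measurableType d)
    (fam : nat -> T -> seq (seq R)) (Pr : probability T R) (mu : nz_point_measure R)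
    (Q : probability (nz_borel R) R) :
  branching_Markov_chain fam p P Pr mu ->
  (forall A : set (nz_borel R), measurable A ->
    Q A = (r^-1%:E * yag (nzpm @^-1` A))%E) ->
  conditional_law_cvg fam Pr Q.
Proof.
move=> H QE f cf bf.
pose S := mseq (measurableTypeR R).
have ma : measurable (alive : set S) := measurable_alive.
have m0 : 0 < mean p := mean_gt0 C1.
have mn0 n : 0 < mean p ^+ n by rewrite exprn_gt0.
pose k := fine (mu setT).
have [j muT] := @pm_natural _ mu setT measurableT.
have k0 : 0 < k.
  have := nz_neq0 mu; rewrite /k muT eqe pnatr_eq0 -lt0n => j0.
  by rewrite /= ltr0n.
pose F (s : S) := f (nzpm s).
have mf : measurable_fun setT (f : nz_borel R -> R) by exact: continuous_measurable_nz.
have mF : measurable_fun setT F by exact: measurableT_comp mf measurable_nzpm.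
have bF : [bounded F s | s in setT].
  by have [M [Mr fM]] := bf; exists M; split => // c Mc s _; exact: (fM c Mc (nzpm s)).
have yagT := yaglom_setT C1 C3.
have QF : \int[Q]_nu f nu = r^-1 * \int[yag]_s F s.
  have QE' (A : set (nz_borel R)) : measurable A ->
      Q A = (r^-1%:E * yag (nzpm @^-1` A `&` setT))%E.
    by rewrite setIT; exact: QE.
  exact: (Rintegral_transfer rV0 measurableT measurable_nzpm QE' yagT mf bf).
have mnV n : 0 <= (mean p ^+ n)^-1 by rewrite invr_ge0 ltW.
(* The law of generation n on survival, divided by m^n instead of the survival probability; it
   converges setwise to [nul]. *)
pose nu n : {measure set S -> \bar R} :=
  mscale (NngNum (mnV n)) (mrestr (gen_law H n) ma).
pose nul : {measure set S -> \bar R} := mscale (NngNum (ltW k0)) yag.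
pose D n := generation fam n @^-1` (alive : set (seq R)).
have mgen n : measurable_fun setT (generation fam n : T -> S) := measurable_generation H n.
have mD n : measurable (D n).
  by rewrite -[X in measurable X]setTI; exact: mgen.
have nuE n A : nu n A = ((mean p ^+ n)^-1%:E * Pr (generation fam n @^-1` A `&` D n))%E by [].
have nulE A : nul A = (k%:E * yag A)%E by [].
have PrT : (Pr setT < +oo)%E by rewrite probability_setT ltry.
have nuF n : \int[nu n]_s F s =
    (mean p ^+ n)^-1 * \int[Pr]_(w in D n) F (generation fam n w).
  exact: (Rintegral_transfer (mnV n) (mD n) (mgen n) _ PrT mF bF).
have nulF : \int[nul]_s F s = k * \int[yag]_s F s.
  have nulE' (A : set S) : measurable A -> nul A = (k%:E * yag (id @^-1` A `&` setT))%E.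
    by rewrite setIT.
  exact: (Rintegral_transfer (ltW k0) measurableT (@measurable_id _ S setT) nulE'
    yagT mF bF).
have nu_cvg (A : set S) : measurable A -> fine (nu n A) @[n --> \oo] --> fine (nul A).
  move=> mA; have := @generation_norm_cvg _ _ _ _ _ _ _ _ H _ C1 C3 A mA.
  rewrite nulE fineM ?(yaglomP C1 C3 mA).1// => h.
  rewrite (_ : (fun n => _) = (fun n =>
    fine (Pr (generation fam n @^-1` (A `&` alive))) / mean p ^+ n))//.
  apply/funext => n; rewrite preimage_setI -/(D n) nuE.
  have fin : Pr (generation fam n @^-1` A `&` D n) \is a fin_num.
    apply: fin_num_measure; apply: measurableI => //.
    by rewrite -[X in measurable X]setTI; exact: mgen.
  by rewrite -(fineK fin) -EFinM /= mulrC.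
have intcvg : \int[nu n]_s F s @[n --> \oo] --> \int[nul]_s F s.
  apply: cvg_Rintegral_setwise => //.
  - move=> n; rewrite nuE; apply: lte_mul_pinfty; rewrite ?lee_fin//.
    apply: (le_lt_trans _ PrT); apply: le_measure; rewrite ?inE//.
    by rewrite preimage_setT setTI.
  - by rewrite nulE; apply: lte_mul_pinfty; rewrite ?lee_fin// ltW.
rewrite QF.
have -> : r^-1 * \int[yag]_s F s = (k * \int[yag]_s F s) / (k * r).
  by rewrite invfM mulrACA divff ?gt_eqF// mul1r mulrC.
have Dcvg : fine (Pr (D n)) / mean p ^+ n @[n --> \oo] --> k * r.
  have := @generation_norm_cvg _ _ _ _ _ _ _ _ H _ C1 C3 _ measurableT.
  by under eq_fun do rewrite setTI.
rewrite (_ : (fun n => _) = (fun n => \int[nu n]_s F s / (fine (Pr (D n)) / mean p ^+ n))).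
  rewrite -nulF; apply: cvgM => //; apply: cvgV => //.
  by rewrite mulf_neq0// gt_eqF.
apply/funext => n; rewrite nuF /survival_expectation.
have -> : [set w | (0 < Nn fam n w)%E] = D n.
  by apply/seteqP; split=> w; rewrite /Nn /= /Zn pm_of_seq_setT lte_fin ltr0n.
rewrite invf_div [in RHS]mulrC mulrACA divff ?gt_eqF// mul1r mulrC.
by congr (_ * _); exact: eq_Rintegral.
Qed.

End conditional_limit.

Theorem theorem2p8 (R : realType) (p : probability nat R)
    (P : R.-pker measurableTypeR R ~> measurableTypeR R)
    (d : measure_display) (Omega : measurableType d)
    (fam : nat -> Omega -> seq (seq R))
    (Pr : nz_point_measure R -> probability Omega R)
    (BMC : forall mu : nz_point_measure R,
       branching_Markov_chain fam p P (Pr mu) mu)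
    (C1 : condition_C1 p) (C2 : condition_C2 p) (C3 : condition_C3 P) :
  exists Qmin : probability (nz_borel R) R,
    (forall mu : nz_point_measure R, conditional_law_cvg fam (Pr mu) Qmin) /\
    (forall Q : probability (nz_borel R) R,
       (forall mu : nz_point_measure R, conditional_law_cvg fam (Pr mu) Q) ->
       forall A : set (nz_borel R), measurable A -> Q A = Qmin A).
Proof.
have [pi C3pi] := C3.
have [Q QE] := yaglom_probability C1 C3pi.
have Qcvg mu : conditional_law_cvg fam (Pr mu) Q.
  exact: conditional_law_cvg_yaglom (BMC mu) QE.
exists Q; split => // Q' Q'cvg A mA.
(* Both probabilities are limits of the same conditional expectations, already for the start
   [point]; the chains started from each [nu] supply the Dirac sums. *)
apply: continuous_tests_unique mA => [nu|f cf bf].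
  exact: chain_dirac_sums (BMC nu).
exact: (cvg_unique _ (Q'cvg point f cf bf) (Qcvg point f cf bf)).
Qed.
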